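(* There is a translation $A\mapsto A'$ from $\mathcal L_{EM}$-formulas to $\mathcal L_{FS}$-formulas, commuting with the logical connectives and quantifiers and leaving the symbols of $\mathcal L$ unchanged, which translates $\mathrm R(x)$ as $\mathrm C(x)$, $x\in y$ as $\mathrm T(yx)$, and each generator constant as a suitable $\mathcal L_{FS}$-term (with $\mathsf i$ translated as the term $\mathsf{acc}$ described in the context), such that for every $\mathcal L_{EM}$-sentence $A$: if $\mathsf T_0\vdash A$ then $\mathsf{VFU}\vdash A'$. In particular, every $\mathcal L$-theorem of $\mathsf T_0$ is derivable in $\mathsf{VFU}$.
   Context: $\mathsf{TON}$ is the total applicative theory in $\mathcal L$ (constants $\mathsf{k},\mathsf{s},\mathsf{p},\mathsf{p}_0,\mathsf{p}_1,\mathsf{0},\mathsf{s}_\mathsf{N},\mathsf{p}_\mathsf{N},\mathsf{d}_\mathsf{N}$, application, predicate $\mathrm N$; $(x,y):=\mathsf pxy$, $(x)_i:=\mathsf p_ix$) with combinator, pairing, number and numerical-cases axioms, induction on $\mathrm N$, and $\lambda$-abstraction. $\mathcal L_{FS}$ extends $\mathcal L$ by constants $\dot=,\dot\neg,\dot\wedge,\dot\to,\dot\forall,\dot{\mathsf N},\dot{\mathsf T},\mathsf l$ and predicates $\mathrm T,\mathrm U$. Terms $\dot A$ for formulas $A$: $\dot{(s=t)}:=\dot=(s,t)$, $\dot{\mathrm N(s)}:=\dot{\mathsf N}s$, $\dot{\mathrm T(s)}:=\dot{\mathsf T}s$, $\dot{(\neg A)}:=\dot\neg\dot A$, $\dot{(A\wedge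 B)}:=\dot\wedge(\dot A,\dot B)$, $\dot{(A\to B)}:=\dot\to(\dot A,\dot B)$, $\dot{(\forall xA)}:=\dot\forall(\lambda x.\dot A)$. $\mathrm C(f):=\forall x(\mathrm T(fx)\vee\mathrm T(\dot\neg(fx)))$; $f\sqsubset g:=\forall x(\mathrm T(fx)\to\mathrm T(g(fx)))\wedge\forall x(\mathrm T(\dot\neg(fx))\to\mathrm T(g(\dot\neg(fx))))$. $\mathsf{VFU}$: $\mathsf{TON}$ and, for $\mathrm U(u)$ and all $\mathcal L_{FS}$-formulas $A,B$: $\mathrm T(u\dot A)\to A$; $P\to\mathrm T(u\dot P)$ for $\mathcal L$-literals $P$; $\mathrm T(u\,\dot{(A\to B)})\to(\mathrm T(u\dot A)\to\mathrm T(u\dot B))$; $\forall x\,\mathrm T(u\dot A)\to\mathrm T(u\,\dot{(\forall xA)})$; $\mathrm T(u\dot C)$ for each logically valid $C$; $\neg(\mathrm T(ux)\wedge\mathrm T(u(\dot\neg x)))$; $[\mathrm T(ux)\leftrightarrow\mathrm T(u(\dot{\mathsf T}x))]\wedge[\mathrm T(u(\dot\neg x))\leftrightarrow\mathrm T(u(\dot\neg(\dot{\mathsf T}x)))]$; $\mathrm C(u)$; $\mathrm T(ux)\to\mathrm T(x)$; and $\mathrm C(f)\to\mathrm U(\mathsf lf)\wedge f\sqsubset\mathsf lf$. Term $\mathsf{acc}$: $a\oplus b:=\lambda x.\,\dot{(\mathrm N((x)_0)\to\mathrm T(\mathsf d_\mathsf N(a(x)_1)(b(x)_1)((x)_0)\mathsf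 0))}$, $\mathsf l_{a,b}:=\mathsf l(a\oplus b)$; $WF[a,b,f]:=\forall x(\mathrm T(ax)\to[\forall y(\mathrm T(ay)\to\mathrm T(b(y,x))\to\mathrm T(\mathsf l_{a,b}(fy)))]\to\mathrm T(\mathsf l_{a,b}(fx)))$; $TI[a,b,z]:=\mathrm T(az)\wedge\forall f(WF[a,b,f]\to\mathrm T(\mathsf l_{a,b}(fz)))$; $\mathsf{acc}(a,b):=\lambda z.\dot{TI[a,b,z]}$. $\mathcal L_{EM}$, $\mathsf T_0$: $\mathcal L$ plus predicate $\mathrm R$, relation $\in$, generators $\mathsf{nat},\mathsf{id},\mathsf{co},\mathsf{int},\mathsf{dom},\mathsf{inv},\mathsf j,\mathsf i$; $\mathsf T_0$ is $\mathsf{TON}$ with axioms for $\mathsf{nat}$ ($x\in\mathsf{nat}\leftrightarrow\mathrm N(x)$), $\mathsf{id}$ ($x\in\mathsf{id}\leftrightarrow\exists y\,x=(y,y)$), complements, intersections, domains ($x\in\mathsf{dom}(a)\leftrightarrow\exists y(x,y)\in a$), inverse images ($x\in\mathsf{inv}(a,f)\leftrightarrow fx\in a$), joins ($\mathrm R(x)\wedge\forall y\in x\,\mathrm R(fy)\to\mathrm R(\mathsf j(x,f))\wedge\forall u(u\in\mathsf j(x,f)\leftrightarrow\exists v,w(u=(v,w)\wedge v\in x\wedge w\in fv))$), each asserting that the result is a name ($\mathrm R$) when the arguments are, and inductive generation $\mathrm R(a)\wedge\mathrm R(b)\to\mathrm R(\mathsf i(a,b))\wedge\mathsf{Closed}(a,b,\bullet\in\mathsf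 i(a,b))$, $\mathrm R(a)\wedge\mathrm R(b)\wedge\mathsf{Closed}(a,b,A)\to\forall x\in\mathsf i(a,b)\,A(x)$ for all $A$, with $\mathsf{Closed}(a,b,A):=\forall x\in a([\forall y\in a((y,x)\in b\to A(y))]\to A(x))$.
   Formalization: VFU is given the additional axiom ∃u U(u): the listed axioms are all conditional on U(u) or C(f), so they hold with T and U empty, and then C(nat') fails although T_0 proves R(nat). *)

(* Defs.v *)
From Stdlib Require Import List.
Import ListNotations.

Set Implicit Arguments.
Unset Strict Implicit.

(** Every language here extends the applicative language L by constants, unary
    predicates and binary predicates.  Variables are de Bruijn indices, in
    terms and in formulas alike; the only binder is [All].  The primitive
    connectives are those for which L_FS has a dotted constant. *)

Record signature := Signature {
  con : Type;
  rel1 : Type;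
  rel2 : Type }.

Inductive lcon : Type := k_ | s_ | p_ | p0_ | p1_ | zero_ | sN_ | pN_ | dN_.

Section Syntax.
Variable S : signature.

Inductive tm : Type :=
| Var (n : nat)
| Cst (c : lcon)
| Ext (c : con S)
| App (t1 t2 : tm).

Inductive fm : Type :=
| Eq (t1 t2 : tm)
| Nat (t : tm)
| Rel1 (r : rel1 S) (t : tm)
| Rel2 (r : rel2 S) (t1 t2 : tm)
| Neg (A : fm)
| And (A B : fm)
| Imp (A B : fm)
| All (A : fm).

Definition Or (A B : fm) : fm := Neg (And (Neg A) (Neg B)).
Definition Iff (A B : fm) : fm := And (Imp A B) (Imp B A).
Definition Ex (A : fm) : fm := Neg (All (Neg A)).

Fixpoint subst_tm (sigma : nat -> tm) (t : tm) : tm :=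
  match t with
  | Var n => sigma n
  | Cst c => Cst c
  | Ext c => Ext c
  | App t1 t2 => App (subst_tm sigma t1) (subst_tm sigma t2)
  end.

Definition lift : tm -> tm := subst_tm (fun n => Var (1 + n)).

Definition scons (t : tm) (sigma : nat -> tm) (n : nat) : tm :=
  match n with 0 => t | Datatypes.S m => sigma m end.

Definition up (sigma : nat -> tm) : nat -> tm :=
  scons (Var 0) (fun n => lift (sigma n)).

Fixpoint subst_fm (sigma : nat -> tm) (A : fm) : fm :=
  match A with
  | Eq t1 t2 => Eq (subst_tm sigma t1) (subst_tm sigma t2)
  | Nat t => Nat (subst_tm sigma t)
  | Rel1 r t => Rel1 r (subst_tm sigma t)
  | Rel2 r t1 t2 => Rel2 r (subst_tm sigma t1) (subst_tm sigma t2)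
  | Neg A => Neg (subst_fm sigma A)
  | And A B => And (subst_fm sigma A) (subst_fm sigma B)
  | Imp A B => Imp (subst_fm sigma A) (subst_fm sigma B)
  | All A => All (subst_fm (up sigma) A)
  end.

Definition lift_fm : fm -> fm := subst_fm (fun n => Var (1 + n)).

(** [inst A t] is A(t), where A(x) has the variable 0 for x. *)
Definition inst (A : fm) (t : tm) : fm := subst_fm (scons t Var) A.

Fixpoint closed_tm (n : nat) (t : tm) : Prop :=
  match t with
  | Var m => m < n
  | Cst _ | Ext _ => True
  | App t1 t2 => closed_tm n t1 /\ closed_tm n t2
  end.

Fixpoint closed_fm (n : nat) (A : fm) : Prop :=
  match A with
  | Eq t1 t2 | Rel2 _ t1 t2 => closed_tm n t1 /\ closed_tm n t2
  | Nat t | Rel1 _ t => closed_tm n t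
  | Neg A => closed_fm n A
  | And A B | Imp A B => closed_fm n A /\ closed_fm n B
  | All A => closed_fm (1 + n) A
  end.

Definition sentence : fm -> Prop := closed_fm 0.

(** [drop t] is [Some t'] with [t = lift t'] if the variable 0 does not occur
    in [t], and [None] otherwise. *)
Fixpoint drop (t : tm) : option tm :=
  match t with
  | Var 0 => None
  | Var (Datatypes.S n) => Some (Var n)
  | Cst c => Some (Cst c)
  | Ext c => Some (Ext c)
  | App t1 t2 =>
      match drop t1, drop t2 with
      | Some t1', Some t2' => Some (App t1' t2')
      | _, _ => None
      end
  end.

(** Abstraction of the variable 0: (lambda x. x) = s k k, (lambda x. t) = k t
    if x is not free in t, and (lambda x. t1 t2) = s (lambda x. t1)
    (lambda x. t2) otherwise.  With the clause for x not free in t stated for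
    all t, abstraction commutes with substitution. *)
Fixpoint lam (t : tm) : tm :=
  match drop t with
  | Some t' => App (Cst k_) t'
  | None =>
      match t with
      | App t1 t2 => App (App (Cst s_) (lam t1)) (lam t2)
      | _ => App (App (Cst s_) (Cst k_)) (Cst k_)
      end
  end.

End Syntax.

Arguments Var {S} n.
Arguments Cst {S} c.
Arguments Ext {S} c.

Declare Scope fm_scope.
Delimit Scope fm_scope with fm.
Bind Scope fm_scope with fm.
Bind Scope fm_scope with tm.

Notation "s · t" := (App s t) (at level 39, left associativity) : fm_scope.
Notation "⟨ s , t ⟩" := (App (App (Cst p_) s) t)
  (at level 0, s at level 69, t at level 69) : fm_scope.
Notation "s ≐ t" := (Eq s t) (at level 70, no associativity) : fm_scope.
Notation "¬ A" := (Neg A) (at level 75, right associativity) : fm_scope.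
Notation "A ∧ B" := (And A B) (at level 80, right associativity) : fm_scope.
Notation "A ∨ B" := (Or A B) (at level 85, right associativity) : fm_scope.
Notation "A ↔ B" := (Iff A B) (at level 95, no associativity) : fm_scope.
Notation "A → B" := (Imp A B) (at level 99, right associativity) : fm_scope.

Local Open Scope fm_scope.

(** Classical natural deduction with equality.  The axioms of a theory are
    formulas that may have free variables; as [prv_ax] is available in every
    context while [prv_allI] only lifts the hypotheses, they act through their
    universal closures. *)

Section Derivability.
Variable S : signature.
Variable Ax : fm S -> Prop.

Inductive prv : list (fm S) -> fm S -> Prop :=
| prv_ax G A : Ax A -> prv G A
| prv_hyp G A : In A G -> prv G A
| prv_negI G A B : prv (A :: G) B -> prv (A :: G) (¬ B) -> prv G (¬ A)
| prv_raa G A B : prv ((¬ A) :: G) B -> prv ((¬ A) :: G) (¬ B) -> prv G A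
| prv_andI G A B : prv G A -> prv G B -> prv G (A ∧ B)
| prv_andE1 G A B : prv G (A ∧ B) -> prv G A
| prv_andE2 G A B : prv G (A ∧ B) -> prv G B
| prv_impI G A B : prv (A :: G) B -> prv G (A → B)
| prv_impE G A B : prv G (A → B) -> prv G A -> prv G B
| prv_allI G A : prv (map (@lift_fm S) G) A -> prv G (All A)
| prv_allE G A t : prv G (All A) -> prv G (inst A t)
| prv_refl G t : prv G (t ≐ t)
| prv_eqE G A t1 t2 : prv G (t1 ≐ t2) -> prv G (inst A t1) -> prv G (inst A t2).

Definition proves (A : fm S) : Prop := prv [] A.

End Derivability.

Notation "Th ⊢ A" := (proves Th A%fm) (at level 100, no associativity).

Record structure (S : signature) := Structure {
  dom :> Type;
  m_lcon : lcon -> dom;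
  m_con : con S -> dom;
  m_app : dom -> dom -> dom;
  m_nat : dom -> Prop;
  m_rel1 : rel1 S -> dom -> Prop;
  m_rel2 : rel2 S -> dom -> dom -> Prop }.

Section Semantics.
Variables (S : signature) (M : structure S).

Fixpoint eval (rho : nat -> M) (t : tm S) : M :=
  match t with
  | Var n => rho n
  | Cst c => m_lcon M c
  | Ext c => m_con M c
  | App t1 t2 => m_app (eval rho t1) (eval rho t2)
  end.

Definition env_cons (d : M) (rho : nat -> M) (n : nat) : M :=
  match n with 0 => d | Datatypes.S m => rho m end.

Fixpoint sat (rho : nat -> M) (A : fm S) : Prop :=
  match A with
  | Eq t1 t2 => eval rho t1 = eval rho t2
  | Nat t => m_nat (eval rho t)
  | Rel1 r t => m_rel1 r (eval rho t)
  | Rel2 r t1 t2 => m_rel2 r (eval rho t1) (eval rho t2)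
  | Neg A => ~ sat rho A
  | And A B => sat rho A /\ sat rho B
  | Imp A B => sat rho A -> sat rho B
  | All A => forall d : M, sat (env_cons d rho) A
  end.

End Semantics.

Definition valid (S : signature) (A : fm S) : Prop :=
  forall (M : structure S) (rho : nat -> M), sat rho A.

(** Axioms are given for arbitrary terms, i.e. closed under substitution.  The
    induction schema ranges over all formulas of the language at hand. *)

Section TON.
Variable S : signature.
Implicit Types (x y z u v : tm S) (A : fm S).

Notation k := (@Cst S k_).
Notation s := (@Cst S s_).
Notation p0 := (@Cst S p0_).
Notation p1 := (@Cst S p1_).
Notation O := (@Cst S zero_).
Notation sN := (@Cst S sN_).
Notation pN := (@Cst S pN_).
Notation dN := (@Cst S dN_).

Inductive TON : fm S -> Prop :=
| ton_k x y : TON (k · x · y ≐ x)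
| ton_s x y z : TON (s · x · y · z ≐ x · z · (y · z))
| ton_pair x y : TON (p0 · ⟨x, y⟩ ≐ x ∧ p1 · ⟨x, y⟩ ≐ y)
| ton_zero : TON (Nat O)
| ton_succ x : TON (Nat x → Nat (sN · x))
| ton_pred_succ x : TON (Nat x → ¬ (sN · x ≐ O) ∧ pN · (sN · x) ≐ x)
| ton_succ_pred x :
    TON (Nat x → ¬ (x ≐ O) → Nat (pN · x) ∧ sN · (pN · x) ≐ x)
| ton_cases_eq x y u v :
    TON (Nat u ∧ Nat v ∧ u ≐ v → dN · x · y · u · v ≐ x)
| ton_cases_neq x y u v :
    TON (Nat u ∧ Nat v ∧ ¬ (u ≐ v) → dN · x · y · u · v ≐ y)
| ton_ind A :
    TON (inst A O ∧
         All (Nat (Var 0) → A →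
              subst_fm (scons (sN · Var 0) (fun n => Var (1 + n))) A) →
         All (Nat (Var 0) → A)).

End TON.

Definition sigL : signature := Signature Empty_set Empty_set Empty_set.

Section Embedding.
Variable S : signature.

Fixpoint emb_tm (t : tm sigL) : tm S :=
  match t with
  | Var n => Var n
  | Cst c => Cst c
  | Ext c => match c : Empty_set with end
  | App t1 t2 => App (emb_tm t1) (emb_tm t2)
  end.

Fixpoint emb (A : fm sigL) : fm S :=
  match A with
  | Eq t1 t2 => Eq (emb_tm t1) (emb_tm t2)
  | Nat t => Nat (emb_tm t)
  | Rel1 r _ => match r : Empty_set with end
  | Rel2 r _ _ => match r : Empty_set with end
  | Neg A => Neg (emb A)
  | And A B => And (emb A) (emb B)
  | Imp A B => Imp (emb A) (emb B)
  | All A => All (emb A)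
  end.

End Embedding.

Definition literal (P : fm sigL) : Prop :=
  match P with
  | Eq _ _ | Nat _ | Neg (Eq _ _) | Neg (Nat _) => True
  | _ => False
  end.

Inductive fs_con : Type :=
  dEq | dNeg | dAnd | dImp | dAll | dNat | dTrue | l_.
Inductive fs_rel : Type := relT | relU.

Definition sigFS : signature := Signature fs_con fs_rel Empty_set.

Notation fs c := (@Ext sigFS c).
Notation T t := (@Rel1 sigFS relT t).
Notation U t := (@Rel1 sigFS relU t).

(** L_FS has no dotted constant for U, so the code of A exists only if U does
    not occur in A. *)
Fixpoint U_free (A : fm sigFS) : Prop :=
  match A with
  | Rel1 relU _ => False
  | Neg A | All A => U_free A
  | And A B | Imp A B => U_free A /\ U_free B
  | _ => True
  end.

(** The value at [U t] is junk; [code] is only used on [U_free] formulas. *)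
Fixpoint code (A : fm sigFS) : tm sigFS :=
  match A with
  | Eq t1 t2 => fs dEq · ⟨t1, t2⟩
  | Nat t => fs dNat · t
  | Rel1 relT t => fs dTrue · t
  | Rel1 relU _ => Cst zero_
  | Rel2 r _ _ => match r : Empty_set with end
  | Neg A => fs dNeg · code A
  | And A B => fs dAnd · ⟨code A, code B⟩
  | Imp A B => fs dImp · ⟨code A, code B⟩
  | All A => fs dAll · lam (code A)
  end.

Definition Cl (f : tm sigFS) : fm sigFS :=
  All (T (lift f · Var 0) ∨ T (fs dNeg · (lift f · Var 0))).

Definition sub (f g : tm sigFS) : fm sigFS :=
  All (T (lift f · Var 0) → T (lift g · (lift f · Var 0))) ∧
  All (T (fs dNeg · (lift f · Var 0)) →
       T (lift g · (fs dNeg · (lift f · Var 0)))).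

Section VFU.
Implicit Types (u f x : tm sigFS) (A B C : fm sigFS).

Inductive VFU : fm sigFS -> Prop :=
| vfu_ton A : TON A -> VFU A
| vfu_out u A : U_free A -> VFU (U u → T (u · code A) → A)
| vfu_literal u (P : fm sigL) :
    literal P -> VFU (U u → emb sigFS P → T (u · code (emb sigFS P)))
| vfu_imp u A B :
    U_free A -> U_free B ->
    VFU (U u → T (u · code (A → B)) → T (u · code A) → T (u · code B))
| vfu_all u A :
    U_free A -> VFU (U u → All (T (lift u · code A)) → T (u · code (All A)))
| vfu_log u C : U_free C -> valid C -> VFU (U u → T (u · code C))
| vfu_cons u x : VFU (U u → ¬ (T (u · x) ∧ T (u · (fs dNeg · x))))
| vfu_rep u x :
    VFU (U u → (T (u · x) ↔ T (u · (fs dTrue · x))) ∧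
               (T (u · (fs dNeg · x)) ↔ T (u · (fs dNeg · (fs dTrue · x)))))
| vfu_class u : VFU (U u → Cl u)
| vfu_true u x : VFU (U u → T (u · x) → T x)
| vfu_limit f : VFU (Cl f → U (fs l_ · f) ∧ sub f (fs l_ · f))
(** There is a universe (equivalently, something is true).  All the axioms
    above are conditional on U(u) or on C(f), so without this one they hold
    with T and U empty over any model of TON, and C(f) has no instance. *)
| vfu_nonempty : VFU (Ex (U (Var 0))).

End VFU.

(** A parenthesised argument list f(a, b) is the application of f to the pair
    ⟨a, b⟩.  The parameters of the definitions below are terms of the ambient
    context, and are lifted once for each binder. *)

Definition oplus (a b : tm sigFS) : tm sigFS :=
  let x := Var 0 in
  lam (code (Nat (Cst p0_ · x) →
             T (Cst dN_ · (lift a · (Cst p1_ · x)) · (lift b · (Cst p1_ · x))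
                  · (Cst p0_ · x) · Cst zero_))).

Definition l_of (a b : tm sigFS) : tm sigFS := fs l_ · oplus a b.

Definition WF (a b f : tm sigFS) : fm sigFS :=
  let u := l_of a b in
  All (T (lift a · Var 0) →
       All (T (lift (lift a) · Var 0) →
            T (lift (lift b) · ⟨Var 0, Var 1⟩) →
            T (lift (lift u) · (lift (lift f) · Var 0))) →
       T (lift u · (lift f · Var 0))).

Definition TI (a b z : tm sigFS) : fm sigFS :=
  T (a · z) ∧
  All (WF (lift a) (lift b) (Var 0) →
       T (lift (l_of a b) · (Var 0 · lift z))).

(** acc = lambda w z. code TI[(w)_0, (w)_1, z] *)
Definition acc : tm sigFS :=
  lam (lam (code (TI (Cst p0_ · Var 1) (Cst p1_ · Var 1) (Var 0)))).

Inductive em_con : Type := nat_ | id_ | co_ | int_ | dom_ | inv_ | j_ | i_.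
Inductive em_rel1 : Type := relR.
Inductive em_rel2 : Type := relIn.

Definition sigEM : signature := Signature em_con em_rel1 em_rel2.

Notation em c := (@Ext sigEM c).
Notation R t := (@Rel1 sigEM relR t).
Notation "s ∈ t" := (@Rel2 sigEM relIn s t) (at level 70, no associativity)
  : fm_scope.

(** [Closed a b A]: A(x) has the variable 0 for x.  In the inner formula y is
    the variable 0 and x the variable 1. *)
Definition Closed (a b : tm sigEM) (A : fm sigEM) : fm sigEM :=
  All (Var 0 ∈ lift a →
       All (Var 0 ∈ lift (lift a) →
            ⟨Var 0, Var 1⟩ ∈ lift (lift b) →
            subst_fm (scons (Var 0) (fun n => Var (2 + n))) A) →
       A).

Section T0.
Implicit Types (a b f x : tm sigEM) (A : fm sigEM).

Inductive T0 : fm sigEM -> Prop :=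
| t0_ton A : TON A -> T0 A
| t0_nat : T0 (R (em nat_) ∧ All (Var 0 ∈ em nat_ ↔ Nat (Var 0)))
| t0_id :
    T0 (R (em id_) ∧
        All (Var 0 ∈ em id_ ↔ Ex (Var 1 ≐ ⟨Var 0, Var 0⟩)))
| t0_co a :
    T0 (R a →
        R (em co_ · a) ∧
        All (Var 0 ∈ lift (em co_ · a) ↔ ¬ (Var 0 ∈ lift a)))
| t0_int a b :
    T0 (R a ∧ R b →
        R (em int_ · ⟨a, b⟩) ∧
        All (Var 0 ∈ lift (em int_ · ⟨a, b⟩) ↔
             Var 0 ∈ lift a ∧ Var 0 ∈ lift b))
| t0_dom a :
    T0 (R a →
        R (em dom_ · a) ∧
        All (Var 0 ∈ lift (em dom_ · a) ↔
             Ex (⟨Var 1, Var 0⟩ ∈ lift (lift a))))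
| t0_inv a f :
    T0 (R a →
        R (em inv_ · ⟨a, f⟩) ∧
        All (Var 0 ∈ lift (em inv_ · ⟨a, f⟩) ↔ lift f · Var 0 ∈ lift a))
| t0_join x f :
    T0 (R x ∧ All (Var 0 ∈ lift x → R (lift f · Var 0)) →
        R (em j_ · ⟨x, f⟩) ∧
        All (Var 0 ∈ lift (em j_ · ⟨x, f⟩) ↔
             Ex (Ex (Var 2 ≐ ⟨Var 1, Var 0⟩ ∧
                     Var 1 ∈ lift (lift (lift x)) ∧
                     Var 0 ∈ lift (lift (lift f)) · Var 1))))
| t0_ig_closed a b :
    T0 (R a ∧ R b →
        R (em i_ · ⟨a, b⟩) ∧ Closed a b (Var 0 ∈ lift (em i_ · ⟨a, b⟩)))
| t0_ig_ind a b A :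
    T0 (R a ∧ R b ∧ Closed a b A →
        All (Var 0 ∈ lift (em i_ · ⟨a, b⟩) → A)).

End T0.

Section Translation.
Variable g : em_con -> tm sigFS.

Fixpoint tr_tm (t : tm sigEM) : tm sigFS :=
  match t with
  | Var n => Var n
  | Cst c => Cst c
  | Ext c => g c
  | App t1 t2 => App (tr_tm t1) (tr_tm t2)
  end.

Fixpoint tr (A : fm sigEM) : fm sigFS :=
  match A with
  | Eq t1 t2 => Eq (tr_tm t1) (tr_tm t2)
  | Nat t => Nat (tr_tm t)
  | Rel1 relR t => Cl (tr_tm t)
  | Rel2 relIn t1 t2 => T (tr_tm t2 · tr_tm t1)
  | Neg A => Neg (tr A)
  | And A B => And (tr A) (tr B)
  | Imp A B => Imp (tr A) (tr B)
  | All A => All (tr A)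
  end.

End Translation.

(* Main.v *)
(** By soundness and completeness of the calculus it is enough to turn every
    model M of VFU into a model of T0, by reading R as C and x ∈ y as T(yx).
    The codes of formulas that hold in a universe u are closed under logic and
    under the omega rule of M; hence u decides every formula whose T-atoms it
    decides, and λx.Ȧ is a class once each instance A(x) is decided by some
    universe.  The universe l(a ⊕ b) extends the classes a and b, and iterating
    limits yields universes for all the generators.

    Inductive generation must be proved for every formula A, decided or not.
    Instantiate f in TI by λx.code(Closed(A) → A(x)).  Since u := l(a ⊕ b)
    decides the atoms T(ay) and T(b(y, x)), progressiveness of f inside u is a
    matter of pure logic, so T(u(fz)); the reflection axiom T(uȦ) → A then
    gives Closed(A) → A(z). *)

From Stdlib Require Import List Arith Lia Cantor.
From Stdlib Require Import Classical ClassicalEpsilon FunctionalExtensionality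
  PropExtensionality ProofIrrelevance.
Require Import Defs.
Import ListNotations.

Set Implicit Arguments.
Unset Strict Implicit.

Local Open Scope fm_scope.

(** * Substitution *)

Section Substitution.
Variable S : signature.
Implicit Types (sigma tau : nat -> tm S) (t : tm S) (A : fm S).

Lemma subst_tm_comp sigma tau t :
  subst_tm tau (subst_tm sigma t) =
  subst_tm (fun n => subst_tm tau (sigma n)) t.
Proof. induction t; simpl; congruence. Qed.

Lemma subst_tm_Var t : subst_tm Var t = t.
Proof. induction t; simpl; congruence. Qed.

Lemma subst_tm_lift sigma t :
  subst_tm sigma (lift t) = subst_tm (fun n => sigma (1 + n)) t.
Proof. apply subst_tm_comp. Qed.

Lemma subst_scons_lift s t : subst_tm (scons s Var) (lift t) = t.
Proof. rewrite subst_tm_lift; apply subst_tm_Var. Qed.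

Lemma up_comp sigma tau :
  (fun n => subst_tm (up tau) (up sigma n)) =
  up (fun n => subst_tm tau (sigma n)).
Proof.
  extensionality n; destruct n as [|n]; simpl; [reflexivity|].
  rewrite subst_tm_lift; unfold lift; now rewrite subst_tm_comp.
Qed.

Lemma up_Var : up (@Var S) = Var.
Proof. now extensionality n; destruct n. Qed.

Lemma up_scons sigma t :
  (fun n => subst_tm (scons t Var) (up sigma n)) = scons t sigma.
Proof.
  extensionality n; destruct n as [|n]; simpl; [reflexivity|].
  rewrite subst_tm_lift; apply subst_tm_Var.
Qed.

Lemma scons_comp sigma tau t :
  (fun n => subst_tm tau (scons t sigma n)) =
  scons (subst_tm tau t) (fun n => subst_tm tau (sigma n)).
Proof. now extensionality n; destruct n. Qed.

Lemma subst_fm_comp A : forall sigma tau,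
  subst_fm tau (subst_fm sigma A) =
  subst_fm (fun n => subst_tm tau (sigma n)) A.
Proof.
  induction A; intros; simpl;
    rewrite ?subst_tm_comp, ?IHA, ?IHA1, ?IHA2; trivial.
  now rewrite <- up_comp.
Qed.

Lemma subst_fm_Var A : subst_fm Var A = A.
Proof.
  induction A; simpl; rewrite ?up_Var, ?subst_tm_Var; congruence.
Qed.

Lemma inst_up A sigma t :
  inst (subst_fm (up sigma) A) t = subst_fm (scons t sigma) A.
Proof. unfold inst; rewrite subst_fm_comp; f_equal; apply up_scons. Qed.

Lemma subst_inst A sigma t :
  subst_fm sigma (inst A t) = inst (subst_fm (up sigma) A) (subst_tm sigma t).
Proof.
  rewrite inst_up; unfold inst; rewrite subst_fm_comp; f_equal.
  apply scons_comp.
Qed.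

Lemma subst_lift_fm A sigma :
  subst_fm (up sigma) (lift_fm A) = lift_fm (subst_fm sigma A).
Proof. unfold lift_fm; now rewrite !subst_fm_comp. Qed.

Lemma subst_tm_ext_closed t n sigma tau :
  closed_tm n t -> (forall m, m < n -> sigma m = tau m) ->
  subst_tm sigma t = subst_tm tau t.
Proof. intros Ht E; induction t; simpl in *; f_equal; firstorder. Qed.

Lemma subst_fm_ext_closed A : forall n sigma tau,
  closed_fm n A -> (forall m, m < n -> sigma m = tau m) ->
  subst_fm sigma A = subst_fm tau A.
Proof.
  induction A; simpl; intros n sigma tau HA E; f_equal;
    try (apply (@subst_tm_ext_closed _ n); tauto).
  1-5: eapply (IHA n) || eapply (IHA1 n) || eapply (IHA2 n); tauto.
  apply (IHA (1 + n)); trivial.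
  intros [|m] Hm; simpl; [reflexivity|]; rewrite E; [reflexivity|lia].
Qed.

Lemma closed_tm_le n m t : closed_tm n t -> n <= m -> closed_tm m t.
Proof. induction t; simpl; intuition lia. Qed.

Lemma closed_fm_le A : forall n m, closed_fm n A -> n <= m -> closed_fm m A.
Proof.
  induction A; simpl; intros n' m' HA Hle;
    intuition eauto using closed_tm_le.
  apply (IHA (1 + n')); [trivial|lia].
Qed.

Lemma closed_tm_ex t : exists n, closed_tm n t.
Proof.
  induction t as [n|c|c|t1 [n1 H1] t2 [n2 H2]].
  - exists (1 + n); simpl; lia.
  - now exists 0.
  - now exists 0.
  - exists (n1 + n2); split; eapply closed_tm_le; eauto; lia.
Qed.

Lemma closed_fm_ex A : exists n, closed_fm n A.
Proof.
  induction A as [t1 t2|t|r t|r t1 t2|A [n Hn]|A [n Hn] B [m Hm]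
    |A [n Hn] B [m Hm]|A [n Hn]].
  - destruct (closed_tm_ex t1) as [n Hn], (closed_tm_ex t2) as [m Hm].
    exists (n + m); split; eapply closed_tm_le; eauto; lia.
  - apply closed_tm_ex.
  - apply closed_tm_ex.
  - destruct (closed_tm_ex t1) as [n Hn], (closed_tm_ex t2) as [m Hm].
    exists (n + m); split; eapply closed_tm_le; eauto; lia.
  - now exists n.
  - exists (n + m); split; eapply closed_fm_le; eauto; lia.
  - exists (n + m); split; eapply closed_fm_le; eauto; lia.
  - exists n; apply (closed_fm_le Hn); lia.
Qed.

End Substitution.

(** * Evaluation under substitution, and soundness *)

Section Semantics.
Variables (S : signature) (M : structure S).
Implicit Types (rho : nat -> M) (sigma : nat -> tm S) (t : tm S) (A : fm S).

Lemma eval_subst rho sigma t :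
  eval rho (subst_tm sigma t) = eval (fun n => eval rho (sigma n)) t.
Proof. induction t; simpl; congruence. Qed.

Lemma eval_lift rho d t : eval (env_cons d rho) (lift t) = eval rho t.
Proof. apply eval_subst. Qed.

Lemma eval_up rho d sigma :
  (fun n => eval (env_cons d rho) (up sigma n)) =
  env_cons d (fun n => eval rho (sigma n)).
Proof.
  extensionality n; destruct n; simpl; [reflexivity|apply eval_lift].
Qed.

Lemma eval_scons rho t sigma :
  (fun n => eval rho (scons t sigma n)) =
  env_cons (eval rho t) (fun n => eval rho (sigma n)).
Proof. now extensionality n; destruct n. Qed.

Lemma sat_subst A : forall rho sigma,
  sat rho (subst_fm sigma A) <-> sat (fun n => eval rho (sigma n)) A.
Proof.
  induction A; simpl; intros; rewrite ?eval_subst, ?IHA, ?IHA1, ?IHA2;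
    try tauto.
  split; intros H d; specialize (H d); rewrite IHA in *;
    rewrite (eval_up rho d sigma) in *; exact H.
Qed.

Lemma sat_inst rho A t :
  sat rho (inst A t) <-> sat (env_cons (eval rho t) rho) A.
Proof. unfold inst; rewrite sat_subst.
  now rewrite (eval_scons rho t Var). Qed.

Lemma sat_lift_fm rho d A : sat (env_cons d rho) (lift_fm A) <-> sat rho A.
Proof. apply sat_subst. Qed.

Lemma sat_Or rho A B : sat rho (A ∨ B) <-> sat rho A \/ sat rho B.
Proof. simpl; tauto. Qed.

Lemma sat_Ex rho A : sat rho (Ex A) <-> exists d, sat (env_cons d rho) A.
Proof.
  simpl; split; [apply not_all_not_ex|].
  intros [d Hd] H; exact (H d Hd).
Qed.

Lemma sat_Iff rho A B : sat rho (A ↔ B) <-> (sat rho A <-> sat rho B).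
Proof. simpl; tauto. Qed.

Lemma eval_closed rho rho' n t :
  closed_tm n t -> (forall m, m < n -> rho m = rho' m) ->
  eval rho t = eval rho' t.
Proof. intros Ht E; induction t; simpl in *; f_equal; firstorder. Qed.

Definition models (Ax : fm S -> Prop) : Prop :=
  forall A rho, Ax A -> sat rho A.

Lemma soundness Ax G A :
  models Ax -> prv Ax G A ->
  forall rho, (forall B, In B G -> sat rho B) -> sat rho A.
Proof.
  intros HM; induction 1; intros rho HG; simpl in *.
  - now apply HM.
  - now apply HG.
  - intros HA; apply (IHprv2 rho); [|apply (IHprv1 rho)];
      intros C [<-|HC]; auto.
  - apply NNPP; intros HA; apply (IHprv2 rho); [|apply (IHprv1 rho)];
      intros C [<-|HC]; auto.
  - auto.
  - now apply IHprv.
  - now apply IHprv.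
  - intros HA; apply IHprv; intros C [<-|HC]; auto.
  - now apply IHprv1; [|apply IHprv2].
  - intros d; apply IHprv; intros C HC.
    apply in_map_iff in HC; destruct HC as [B [<- HB]].
    now apply sat_lift_fm, HG.
  - apply sat_inst, IHprv; auto.
  - reflexivity.
  - rewrite sat_inst, <- IHprv1, <- sat_inst; auto.
Qed.

End Semantics.

(** * Completeness *)

Section Completeness.
Variables (S : signature) (Ax : fm S -> Prop).
Implicit Types (G : list (fm S)) (A B : fm S) (t : tm S).

Lemma prv_weaken G A : prv Ax G A -> forall G', incl G G' -> prv Ax G' A.
Proof.
  induction 1; intros G' HG.
  - now apply prv_ax.
  - now apply prv_hyp, HG.
  - apply prv_negI with B; [apply IHprv1|apply IHprv2];
      apply incl_cons; simpl; auto using incl_tl.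
  - apply prv_raa with B; [apply IHprv1|apply IHprv2];
      apply incl_cons; simpl; auto using incl_tl.
  - apply prv_andI; auto.
  - apply prv_andE1 with B; auto.
  - apply prv_andE2 with A; auto.
  - apply prv_impI, IHprv, incl_cons; simpl; auto using incl_tl.
  - apply prv_impE with A; auto.
  - apply prv_allI, IHprv; auto using incl_map.
  - apply prv_allE; auto.
  - apply prv_refl.
  - apply prv_eqE with t1; auto.
Qed.

(* [prv_ax] holds in every context, so finitely many variables of an axiom can
   be generalized and then instantiated. *)
Lemma prv_ax_subst G A sigma : Ax A -> prv Ax G (subst_fm sigma A).
Proof.
  intros HA; destruct (closed_fm_ex A) as [n Hn].
  (* The first [m] variables are replaced by [sigma] and the others move down by [m], one
     generalization and instantiation at a time. Provability of [B] in every context lets [prv_allI]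
     apply although it lifts the hypotheses. *)
  assert (H : forall m sigma B, (forall G, prv Ax G B) ->
    forall G, prv Ax G
      (subst_fm (fun i => if i <? m then sigma i else Var (i - m)) B)).
  { clear; induction m as [|m IH]; intros sigma B HB G.
    - replace (fun i => _) with (@Var S).
      + now rewrite subst_fm_Var.
      + extensionality i; simpl; f_equal; lia.
    - set (tau := fun i => if i <? m then sigma (1 + i) else Var (i - m)).
      replace (fun i => _) with (scons (sigma 0) tau).
      + rewrite <- inst_up; apply prv_allE.
        apply (IH (fun i => sigma (1 + i)) (All B)).
        intros G'; now apply prv_allI.
      + extensionality i; now destruct i. }
  rewrite (@subst_fm_ext_closed _ A n sigma
    (fun i => if i <? n then sigma i else Var (i - n))); trivial.
  - apply H; intros; now apply prv_ax.
  - intros m Hm; apply Nat.ltb_lt in Hm; now rewrite Hm.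
Qed.

Lemma prv_subst G A :
  prv Ax G A ->
  forall sigma, prv Ax (map (subst_fm sigma) G) (subst_fm sigma A).
Proof.
  induction 1; intros sigma; simpl in *.
  - now apply prv_ax_subst.
  - now apply prv_hyp, in_map.
  - eapply prv_negI; [apply IHprv1|apply IHprv2].
  - eapply prv_raa; [apply IHprv1|apply IHprv2].
  - now apply prv_andI.
  - eapply prv_andE1, IHprv.
  - eapply prv_andE2, IHprv.
  - now apply prv_impI.
  - eapply prv_impE; [apply IHprv1|apply IHprv2].
  - apply prv_allI; specialize (IHprv (up sigma)); rewrite map_map in *.
    erewrite map_ext; [exact IHprv|].
    intros; symmetry; apply subst_lift_fm.
  - rewrite subst_inst; apply prv_allE, IHprv.
  - apply prv_refl.
  - rewrite subst_inst; apply prv_eqE with (subst_tm sigma t1); trivial.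
    rewrite <- subst_inst; apply IHprv2.
Qed.

(** [Var k] lies beyond every free variable of [G] and of [All A]. Renaming [k] to 0 and shifting
    the smaller variables up turns [inst A (Var k)] into [A] and [G] into its lift, as [prv_allI]
    requires. *)
Lemma prv_gen G A k :
  (forall B, In B G -> closed_fm k B) -> closed_fm (1 + k) A ->
  prv Ax G (inst A (Var k)) -> prv Ax G (All A).
Proof.
  intros HG HA H; apply prv_allI.
  set (sigma := fun n => if n <? k then Var (1 + n) else @Var S 0).
  apply (@prv_subst _ _) with (sigma := sigma) in H.
  replace (map (lift_fm (S:=S)) G) with (map (subst_fm sigma) G).
  - rewrite subst_inst, inst_up in H.
    rewrite (@subst_fm_ext_closed _ A (1 + k) _ Var), subst_fm_Var in H;
      trivial.
    intros [|m] Hm; simpl; unfold sigma.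
    + now rewrite Nat.ltb_irrefl.
    + assert (Hm' : m < k) by lia; apply Nat.ltb_lt in Hm'; now rewrite Hm'.
  - apply map_ext_in; intros B HB; apply subst_fm_ext_closed with k; auto.
    intros m Hm; unfold sigma; apply Nat.ltb_lt in Hm; now rewrite Hm.
Qed.

Definition consistent G : Prop :=
  ~ exists B, prv Ax G B /\ prv Ax G (¬ B).

Lemma prv_dne G A : prv Ax G (¬ ¬ A) -> prv Ax G A.
Proof.
  intros H; apply prv_raa with (¬ A); [apply prv_hyp; now left|].
  apply (prv_weaken H), incl_tl, incl_refl.
Qed.

Lemma inconsistent_neg G A : ~ consistent (A :: G) -> prv Ax G (¬ A).
Proof.
  intros H; apply NNPP in H; destruct H as [B [H1 H2]].
  exact (prv_negI H1 H2).
Qed.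

Lemma consistent_counterexample G A :
  consistent G -> prv Ax G (¬ (All A)) ->
  exists k, consistent ((¬ (inst A (Var k))) :: G).
Proof.
  intros HG HA.
  assert (Hk : exists k, forall B, In B (All A :: G) -> closed_fm k B).
  { generalize (All A :: G); intros L; induction L as [|B L [k Hk]].
    - exists 0; now intros.
    - destruct (closed_fm_ex B) as [m Hm]; exists (k + m).
      intros C [<-|HC]; eapply closed_fm_le; eauto; lia. }
  destruct Hk as [k Hk]; exists k; apply NNPP; intros H; apply HG.
  exists (All A); split; [|exact HA].
  apply inconsistent_neg, prv_dne in H.
  apply prv_gen with k; trivial.
  - intros B HB; apply Hk; now right.
  - apply (Hk (All A)); now left.
Qed.

Variable enum : nat -> fm S.
Hypothesis enum_surj : forall A, exists n, enum n = A.

Definition henkin_step G A G' : Prop :=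
  consistent G' /\ incl G G' /\
  (In A G' \/ prv Ax G' (¬ A)) /\
  forall B, A = Neg (All B) -> In A G' ->
    exists k, In (¬ (inst B (Var k))) G'.

Lemma henkin_step_ex G A : consistent G -> exists G', henkin_step G A G'.
Proof.
  intros HG; destruct (classic (consistent (A :: G))) as [HA|HA].
  - destruct (classic (exists B, A = Neg (All B))) as [[B ->]|HB].
    + destruct (@consistent_counterexample (Neg (All B) :: G) B) as [k Hk];
        [exact HA|apply prv_hyp; now left|].
      exists (Neg (inst B (Var k)) :: Neg (All B) :: G); repeat split; trivial.
      * now do 2 apply incl_tl.
      * left; simpl; auto.
      * intros C [= <-] _; exists k; now left.
    + exists (A :: G); repeat split; trivial.
      * now apply incl_tl.
      * left; now left.
      * intros B ->; destruct HB; now exists B.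
  - exists G; repeat split; trivial.
    + apply incl_refl.
    + right; now apply inconsistent_neg.
    + intros B -> H; destruct HG; exists (¬ (All B)); split.
      * now apply prv_hyp.
      * now apply inconsistent_neg.
Qed.

Variable G0 : list (fm S).
Hypothesis G0_consistent : consistent G0.

Definition henkin_next (n : nat) (G : {G | consistent G}) :
    {G | consistent G} :=
  let (G', H) := constructive_indefinite_description _
    (henkin_step_ex (enum n) (proj2_sig G)) in
  exist _ G' (proj1 H).

Fixpoint henkin (n : nat) : {G | consistent G} :=
  match n with
  | 0 => exist _ G0 G0_consistent
  | Datatypes.S n => henkin_next n (henkin n)
  end.

Notation H n := (proj1_sig (henkin n)).

Lemma henkin_spec n : henkin_step (H n) (enum n) (H (1 + n)).
Proof.
  simpl; unfold henkin_next; now destruct constructive_indefinite_description.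
Qed.

Lemma henkin_incl n m : n <= m -> incl (H n) (H m).
Proof.
  induction 1 as [|m _ IH]; [apply incl_refl|].
  apply incl_tran with (1 := IH), (henkin_spec m).
Qed.

(** The limit of the stages, a maximal consistent theory with Henkin witnesses. The lemmas below
    show that it commutes with the connectives and the quantifier like a truth predicate. *)
Definition Th A : Prop := exists n, prv Ax (H n) A.

Lemma Th_1 A B : (forall G, prv Ax G A -> prv Ax G B) -> Th A -> Th B.
Proof. intros HAB [n HA]; exists n; auto. Qed.

Lemma Th_2 A B C :
  (forall G, prv Ax G A -> prv Ax G B -> prv Ax G C) -> Th A -> Th B -> Th C.
Proof.
  intros HABC [n HA] [m HB]; exists (n + m); apply HABC.
  - apply (prv_weaken HA), henkin_incl; lia.
  - apply (prv_weaken HB), henkin_incl; lia.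
Qed.

Lemma Th_0 A : (forall G, prv Ax G A) -> Th A.
Proof. now exists 0. Qed.

Lemma Th_consistent A : Th A -> ~ Th (¬ A).
Proof.
  intros [n HA] [m HB]; destruct (proj2_sig (henkin (n + m))).
  exists A; split.
  - apply (prv_weaken HA), henkin_incl; lia.
  - apply (prv_weaken HB), henkin_incl; lia.
Qed.

Lemma Th_Neg A : Th (¬ A) <-> ~ Th A.
Proof.
  split; [intros H1 H2; exact (Th_consistent H2 H1)|].
  destruct (enum_surj A) as [n <-]; intros HA.
  destruct (henkin_spec n) as (_ & _ & [H|H] & _).
  - destruct HA; exists (1 + n); now apply prv_hyp.
  - now exists (1 + n).
Qed.

Lemma Th_And A B : Th (A ∧ B) <-> Th A /\ Th B.
Proof.
  split.
  - intros H; split; revert H; apply Th_1; intros G.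
    + apply prv_andE1.
    + apply prv_andE2.
  - intros [HA HB]; revert HA HB; apply Th_2; intros G; apply prv_andI.
Qed.

Lemma Th_Imp A B : Th (A → B) <-> (Th A -> Th B).
Proof.
  split; [apply Th_2; intros G; apply prv_impE|intros H].
  destruct (classic (Th A)) as [HA|HA].
  - apply Th_1 with (2 := H HA); intros G HB; apply prv_impI.
    apply (prv_weaken HB), incl_tl, incl_refl.
  - apply Th_Neg in HA; apply Th_1 with (2 := HA); intros G HA'.
    apply prv_impI, prv_raa with A; [apply prv_hyp; simpl; auto|].
    apply (prv_weaken HA'); do 2 apply incl_tl; apply incl_refl.
Qed.

(** If [All A] fails, its negation occurs in the enumeration and must have entered a stage, because
    the theory proves it; its witness then refutes an instance of [A]. *)
Lemma Th_All A : Th (All A) <-> forall t, Th (inst A t).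
Proof.
  split.
  - intros H t; revert H; apply Th_1; intros G; apply prv_allE.
  - intros H; apply NNPP; intros HA; apply Th_Neg in HA.
    destruct (enum_surj (¬ (All A))) as [n E].
    destruct (henkin_spec n) as (_ & _ & H1 & H2); rewrite E in H1, H2.
    destruct H1 as [H1|H1].
    + destruct (H2 A eq_refl H1) as [k Hk].
      apply (Th_consistent (H (Var k))); exists (1 + n); now apply prv_hyp.
    + apply (Th_consistent HA); now exists (1 + n).
Qed.

Lemma Th_eqE A t1 t2 : Th (t1 ≐ t2) -> Th (inst A t1) -> Th (inst A t2).
Proof. apply Th_2; intros G; apply prv_eqE. Qed.

Lemma Th_refl t : Th (t ≐ t).
Proof. apply Th_0; intros; apply prv_refl. Qed.

Lemma Th_sym t1 t2 : Th (t1 ≐ t2) -> Th (t2 ≐ t1).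
Proof.
  intros E; pose proof (Th_eqE (A := Var 0 ≐ lift t1) E) as H.
  unfold inst in H; simpl in H; rewrite !subst_tm_lift, !subst_tm_Var in H.
  apply H, Th_refl.
Qed.

Lemma Th_trans t1 t2 t3 : Th (t1 ≐ t2) -> Th (t2 ≐ t3) -> Th (t1 ≐ t3).
Proof.
  intros E1 E2; pose proof (Th_eqE (A := lift t1 ≐ Var 0) E2) as H.
  unfold inst in H; simpl in H; rewrite !subst_tm_lift, !subst_tm_Var in H.
  auto.
Qed.

Lemma Th_App s1 s2 t1 t2 :
  Th (s1 ≐ t1) -> Th (s2 ≐ t2) -> Th (s1 · s2 ≐ t1 · t2).
Proof.
  intros E1 E2.
  pose proof (Th_eqE (A := lift s1 · lift s2 ≐ Var 0 · lift s2) E1) as H1.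
  pose proof (Th_eqE (A := lift s1 · lift s2 ≐ lift t1 · Var 0) E2) as H2.
  unfold inst in H1, H2; simpl in H1, H2.
  rewrite !subst_scons_lift in H1; rewrite !subst_scons_lift in H2.
  apply H2, H1, Th_refl.
Qed.

Lemma Th_Nat t1 t2 : Th (t1 ≐ t2) -> Th (Nat t1) -> Th (Nat t2).
Proof. apply (Th_eqE (A := Nat (Var 0))). Qed.

Lemma Th_Rel1 r t1 t2 : Th (t1 ≐ t2) -> Th (Rel1 r t1) -> Th (Rel1 r t2).
Proof. apply (Th_eqE (A := Rel1 r (Var 0))). Qed.

Lemma Th_Rel2 r s1 s2 t1 t2 :
  Th (s1 ≐ t1) -> Th (s2 ≐ t2) -> Th (Rel2 r s1 s2) -> Th (Rel2 r t1 t2).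
Proof.
  intros E1 E2 H.
  pose proof (Th_eqE (A := Rel2 r (Var 0) (lift s2)) E1) as H1.
  pose proof (Th_eqE (A := Rel2 r (lift t1) (Var 0)) E2) as H2.
  unfold inst in H1, H2; simpl in H1, H2.
  rewrite !subst_scons_lift in H1; rewrite !subst_scons_lift in H2; auto.
Qed.

(* The model consists of one chosen term from each class of provably equal
   terms. *)
Definition rep t : tm S :=
  epsilon (inhabits t) (fun t' => Th (t ≐ t')).

Lemma rep_spec t : Th (t ≐ rep t).
Proof.
  unfold rep; apply (epsilon_spec (inhabits t) (fun t' => Th (t ≐ t'))).
  exists t; apply Th_refl.
Qed.

Lemma rep_eq t1 t2 : Th (t1 ≐ t2) -> rep t1 = rep t2.
Proof.
  intros E; unfold rep.
  replace (fun t' => Th (t1 ≐ t')) with (fun t' => Th (t2 ≐ t')).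
  - f_equal; apply proof_irrelevance.
  - extensionality t'; apply propositional_extensionality.
    split; intros H; eapply Th_trans; eauto using Th_sym.
Qed.

Definition term_dom : Type := {t | rep t = t}.

Definition cls t : term_dom :=
  exist _ (rep t) (eq_sym (rep_eq (rep_spec t))).

Lemma cls_eq t1 t2 : cls t1 = cls t2 <-> Th (t1 ≐ t2).
Proof.
  split; intros E.
  - apply (f_equal (@proj1_sig _ _)) in E; simpl in E.
    apply Th_trans with (1 := rep_spec t1); rewrite E.
    apply Th_sym, rep_spec.
  - unfold cls; apply eq_sig_hprop; [intros; apply proof_irrelevance|].
    now apply rep_eq.
Qed.

Lemma cls_proj (d : term_dom) : cls (proj1_sig d) = d.
Proof.
  apply eq_sig_hprop; [intros; apply proof_irrelevance|]; exact (proj2_sig d).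
Qed.

Definition term_model : structure S :=
  @Structure S term_dom
    (fun c => cls (Cst c)) (fun c => cls (Ext c))
    (fun d e => cls (proj1_sig d · proj1_sig e))
    (fun d => Th (Nat (proj1_sig d)))
    (fun r d => Th (Rel1 r (proj1_sig d)))
    (fun r d e => Th (Rel2 r (proj1_sig d) (proj1_sig e))).

Lemma eval_term_model sigma t :
  eval (M := term_model) (fun n => cls (sigma n)) t = cls (subst_tm sigma t).
Proof.
  induction t as [n|c|c|t1 IH1 t2 IH2]; simpl; trivial.
  rewrite IH1, IH2; apply cls_eq, Th_App; apply Th_sym, rep_spec.
Qed.

(** The truth lemma. It is stated for all [sigma] because the quantifier case adds a term to it;
    every element is the class of its representative, so quantifying over the domain is quantifying
    over terms. *)
Lemma sat_term_model A : forall sigma,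
  sat (M := term_model) (fun n => cls (sigma n)) A <-> Th (subst_fm sigma A).
Proof.
  induction A as [t1 t2|t|r t|r t1 t2|A IH|A IHA B IHB|A IHA B IHB|A IH];
    intros sigma; simpl; rewrite ?eval_term_model; simpl.
  - apply cls_eq.
  - split; apply Th_Nat; auto using Th_sym, rep_spec.
  - split; apply Th_Rel1; auto using Th_sym, rep_spec.
  - split; apply Th_Rel2; auto using Th_sym, rep_spec.
  - now rewrite IH, Th_Neg.
  - now rewrite IHA, IHB, Th_And.
  - now rewrite IHA, IHB, Th_Imp.
  - rewrite Th_All.
    assert (E : forall t, sat (M := term_model)
        (env_cons (M := term_model) (cls t) (fun n => cls (sigma n))) A <->
      Th (inst (subst_fm (up sigma) A) t)).
    { intros t; rewrite inst_up, <- IH.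
      replace (fun n => cls (scons t sigma n))
        with (env_cons (M := term_model) (cls t) (fun n => cls (sigma n)));
        [reflexivity|].
      now extensionality n; destruct n. }
    split; intros H t; [now apply E|].
    rewrite <- (cls_proj t); now apply E.
Qed.

Lemma models_term_model : models term_model Ax.
Proof.
  intros A rho HA.
  replace rho with (fun n => cls (proj1_sig (rho n))).
  - apply sat_term_model, Th_0; intros G; now apply prv_ax_subst.
  - extensionality n; apply cls_proj.
Qed.

End Completeness.

Lemma completeness (S : signature) (Ax : fm S -> Prop) (enum : nat -> fm S) A :
  (forall A, exists n, enum n = A) ->
  (forall M : structure S, models M Ax -> forall rho : nat -> M, sat rho A) ->
  proves Ax A.
Proof.
  intros Henum HA; apply NNPP; intros Hprv.
  assert (HG : consistent Ax [¬ A]).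
  { intros [B [H1 H2]]; exact (Hprv (prv_raa H1 H2)). }
  specialize (HA _ (models_term_model Henum (G0_consistent := HG))
    (fun n => cls enum HG (Var n))).
  rewrite (sat_term_model Henum), subst_fm_Var in HA.
  refine (Th_consistent HA _); exists 0; apply prv_hyp; now left.
Qed.

(** * Countability of the formulas *)

Section Countability.
Variable S : signature.
Variables (nc : con S -> nat) (n1 : rel1 S -> nat) (n2 : rel2 S -> nat).
Hypothesis nc_inj : forall c c', nc c = nc c' -> c = c'.
Hypothesis n1_inj : forall r r', n1 r = n1 r' -> r = r'.
Hypothesis n2_inj : forall r r', n2 r = n2 r' -> r = r'.

Definition lcon_num (c : lcon) : nat :=
  match c with
  | k_ => 0 | s_ => 1 | p_ => 2 | p0_ => 3 | p1_ => 4
  | zero_ => 5 | sN_ => 6 | pN_ => 7 | dN_ => 8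
  end.

Fixpoint tm_num (t : tm S) : nat :=
  match t with
  | Var n => to_nat (0, n)
  | Cst c => to_nat (1, lcon_num c)
  | Ext c => to_nat (2, nc c)
  | App t1 t2 => to_nat (3, to_nat (tm_num t1, tm_num t2))
  end.

Fixpoint fm_num (A : fm S) : nat :=
  match A with
  | Eq t1 t2 => to_nat (0, to_nat (tm_num t1, tm_num t2))
  | Nat t => to_nat (1, tm_num t)
  | Rel1 r t => to_nat (2, to_nat (n1 r, tm_num t))
  | Rel2 r t1 t2 => to_nat (3, to_nat (n2 r, to_nat (tm_num t1, tm_num t2)))
  | Neg A => to_nat (4, fm_num A)
  | And A B => to_nat (5, to_nat (fm_num A, fm_num B))
  | Imp A B => to_nat (6, to_nat (fm_num A, fm_num B))
  | All A => to_nat (7, fm_num A)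
  end.

Lemma to_nat_pair_inj a b c d :
  to_nat (a, b) = to_nat (c, d) -> a = c /\ b = d.
Proof. intros E; apply to_nat_inj in E; split; congruence. Qed.

Ltac invert_num :=
  repeat match goal with
  | E : to_nat _ = to_nat _ |- _ =>
      apply to_nat_pair_inj in E;
      let E1 := fresh E in destruct E as [E1 E]; try discriminate E1
  end.

Lemma tm_num_inj t t' : tm_num t = tm_num t' -> t = t'.
Proof.
  revert t'; induction t as [n|c|c|t1 IH1 t2 IH2];
    intros [n'|c'|c'|t1' t2'] E; cbn [tm_num] in E; invert_num;
    f_equal; auto.
  now destruct c, c'.
Qed.

Lemma fm_num_inj A A' : fm_num A = fm_num A' -> A = A'.
Proof.
  revert A'; induction A; intros [] E; cbn [fm_num] in E; invert_num;
    f_equal; auto using tm_num_inj.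
Qed.

Lemma fm_enumerable : exists enum : nat -> fm S, forall A, exists n, enum n = A.
Proof.
  (* A left inverse of the injective numbering; [Nat (Var 0)] only witnesses that there are
     formulas. *)
  exists (fun n => epsilon (inhabits (Nat (Var 0))) (fun A => fm_num A = n)).
  intros A; exists (fm_num A); apply fm_num_inj.
  apply (epsilon_spec (inhabits (Nat (Var 0)))
    (fun A' => fm_num A' = fm_num A)).
  now exists A.
Qed.

End Countability.

(** * Codes and abstraction *)

Section Abstraction.
Variable S : signature.
Implicit Types (sigma : nat -> tm S) (t : tm S).

Lemma drop_lift t : drop (lift t) = Some t.
Proof.
  induction t as [n|c|c|t1 IH1 t2 IH2]; trivial.
  change (lift (t1 · t2)) with (lift t1 · lift t2); simpl.
  now rewrite IH1, IH2.
Qed.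

Lemma drop_Some t t' : drop t = Some t' -> t = lift t'.
Proof.
  revert t'; induction t as [[|n]|c|c|t1 IH1 t2 IH2]; simpl; intros t' E;
    try discriminate; try (injection E as <-; reflexivity).
  destruct (drop t1), (drop t2); try discriminate; injection E as <-.
  now rewrite (IH1 _ eq_refl), (IH2 _ eq_refl).
Qed.

Lemma subst_up_lift sigma t :
  subst_tm (up sigma) (lift t) = lift (subst_tm sigma t).
Proof. unfold lift; now rewrite !subst_tm_comp. Qed.

(** [up sigma] fixes the variable 0 and sends the others to lifted terms, so occurrences of 0 are
    neither created nor lost. Hence [lam] takes the same clause before and after a substitution. *)
Lemma drop_subst sigma t :
  drop (subst_tm (up sigma) t) = option_map (subst_tm sigma) (drop t).
Proof.
  induction t as [[|n]|c|c|t1 IH1 t2 IH2]; simpl; trivial.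
  - apply drop_lift.
  - rewrite IH1, IH2; now destruct (drop t1), (drop t2).
Qed.

Lemma lam_lift t : lam (lift t) = Cst k_ · t.
Proof.
  pose proof (drop_lift t) as E.
  destruct (lift t); unfold lam; now rewrite E.
Qed.

Lemma lam_App t1 t2 :
  drop (t1 · t2) = None -> lam (t1 · t2) = Cst s_ · lam t1 · lam t2.
Proof. intros E; cbn [lam]; now rewrite E. Qed.

Lemma subst_lam sigma t :
  subst_tm sigma (lam t) = lam (subst_tm (up sigma) t).
Proof.
  induction t as [n|c|c|t1 IH1 t2 IH2]; trivial.
  - destruct n as [|n]; [reflexivity|].
    symmetry; apply lam_lift.
  - destruct (drop (t1 · t2)) as [t'|] eqn:E.
    + rewrite (drop_Some E), subst_up_lift; now rewrite !lam_lift.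
    + rewrite (lam_App E); cbn [subst_tm].
      rewrite lam_App, IH1, IH2; trivial.
      change (drop (subst_tm (up sigma) (t1 · t2)) = None).
      now rewrite drop_subst, E.
Qed.

End Abstraction.

Lemma code_subst A : forall sigma,
  code (subst_fm sigma A) = subst_tm sigma (code A).
Proof.
  induction A as [t1 t2|t|[] t|[]|A IH|A IHA B IHB|A IHA B IHB|A IH];
    intros sigma; simpl; rewrite ?IH, ?IHA, ?IHB, ?subst_lam; trivial.
Qed.

Lemma U_free_subst A : forall sigma, U_free A -> U_free (subst_fm sigma A).
Proof. induction A as [| |[]|[]| | | |]; simpl; firstorder. Qed.

(** * Models of VFU *)

Section Model.
Variable M : structure sigFS.
Hypothesis HM : models M VFU.
Implicit Types (a b f u v w x y z d : M) (rho : nat -> M).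

Infix "∘" := (@m_app sigFS M) (at level 40, left associativity).
Infix ".:" := (@env_cons sigFS M) (at level 55, right associativity).
Notation "' c" := (m_lcon M c) (at level 9, format "' c").
Notation "# c" := (@m_con sigFS M c) (at level 9, format "# c").
Notation isN := (@m_nat sigFS M).
Notation isT := (@m_rel1 sigFS M relT).
Notation isU := (@m_rel1 sigFS M relU).
Notation pair x y := ('p_ ∘ x ∘ y).
Notation cd rho A := (eval rho (code A)).

Let base : nat -> M := fun _ => 'zero_.

Lemma k_eq x y : 'k_ ∘ x ∘ y = x.
Proof.
  exact (HM (x .: y .: base) (vfu_ton (ton_k (Var 0) (Var 1)))).
Qed.

Lemma s_eq x y z : 's_ ∘ x ∘ y ∘ z = x ∘ z ∘ (y ∘ z).
Proof.
  exact (HM (x .: y .: z .: base)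
    (vfu_ton (ton_s (Var 0) (Var 1) (Var 2)))).
Qed.

Lemma p0_eq x y : 'p0_ ∘ pair x y = x.
Proof.
  exact (proj1 (HM (x .: y .: base) (vfu_ton (ton_pair (Var 0) (Var 1))))).
Qed.

Lemma p1_eq x y : 'p1_ ∘ pair x y = y.
Proof.
  exact (proj2 (HM (x .: y .: base) (vfu_ton (ton_pair (Var 0) (Var 1))))).
Qed.

Lemma zero_nat : isN 'zero_.
Proof. exact (HM base (vfu_ton (ton_zero _))). Qed.

Lemma succ_nat x : isN x -> isN ('sN_ ∘ x).
Proof. exact (HM (x .: base) (vfu_ton (ton_succ (Var 0)))). Qed.

Lemma pred_succ x :
  isN x -> 'sN_ ∘ x <> 'zero_ /\ 'pN_ ∘ ('sN_ ∘ x) = x.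
Proof. exact (HM (x .: base) (vfu_ton (ton_pred_succ (Var 0)))). Qed.

Lemma succ_pred x :
  isN x -> x <> 'zero_ -> isN ('pN_ ∘ x) /\ 'sN_ ∘ ('pN_ ∘ x) = x.
Proof. exact (HM (x .: base) (vfu_ton (ton_succ_pred (Var 0)))). Qed.

Lemma cases_eq x y z w :
  isN z /\ isN w /\ z = w -> 'dN_ ∘ x ∘ y ∘ z ∘ w = x.
Proof.
  exact (HM (x .: y .: z .: w .: base)
    (vfu_ton (ton_cases_eq (Var 0) (Var 1) (Var 2) (Var 3)))).
Qed.

Lemma cases_neq x y z w :
  isN z /\ isN w /\ z <> w -> 'dN_ ∘ x ∘ y ∘ z ∘ w = y.
Proof.
  exact (HM (x .: y .: z .: w .: base)
    (vfu_ton (ton_cases_neq (Var 0) (Var 1) (Var 2) (Var 3)))).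
Qed.

Lemma nat_ind_sat rho A :
  sat ('zero_ .: rho) A ->
  (forall d, isN d -> sat (d .: rho) A -> sat ('sN_ ∘ d .: rho) A) ->
  forall d, isN d -> sat (d .: rho) A.
Proof.
  intros H0 HS; apply (HM rho (vfu_ton (ton_ind A))).
  split; [now apply sat_inst|].
  intros d Hd HA; apply sat_subst; rewrite eval_scons; now apply HS.
Qed.

Lemma eval_lam rho t d : eval rho (lam t) ∘ d = eval (d .: rho) t.
Proof.
  induction t as [n|c|c|t1 IH1 t2 IH2].
  - destruct n as [|n]; simpl; [now rewrite s_eq, k_eq|apply k_eq].
  - apply k_eq.
  - apply k_eq.
  - destruct (drop (t1 · t2)) as [t'|] eqn:E.
    + rewrite (drop_Some E), lam_lift, eval_lift; apply k_eq.
    + rewrite (lam_App E); simpl; now rewrite s_eq, IH1, IH2.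
Qed.

Lemma cd_subst rho sigma A :
  cd rho (subst_fm sigma A) = cd (fun n => eval rho (sigma n)) A.
Proof. rewrite code_subst; apply eval_subst. Qed.

Lemma cd_lift rho d A : cd (d .: rho) (lift_fm A) = cd rho A.
Proof. apply cd_subst. Qed.

(** This is T(vȦ) read in [M]: the code is evaluated under [rho], which supplies arbitrary elements
    of [M] as parameters. *)
Definition holds v rho A : Prop := isT (v ∘ cd rho A).
Definition decides v rho A : Prop := holds v rho A \/ holds v rho (¬ A).
Definition class f : Prop :=
  forall x, isT (f ∘ x) \/ isT (#dNeg ∘ (f ∘ x)).
Definition below f g : Prop :=
  (forall x, isT (f ∘ x) -> isT (g ∘ (f ∘ x))) /\
  (forall x, isT (#dNeg ∘ (f ∘ x)) -> isT (g ∘ (#dNeg ∘ (f ∘ x)))).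

Lemma sat_Cl rho t : sat rho (Cl t) <-> class (eval rho t).
Proof.
  unfold class; split; intros H x; specialize (H x).
  - apply sat_Or in H; simpl in H; now rewrite eval_lift in H.
  - apply sat_Or; simpl; now rewrite eval_lift.
Qed.

Lemma sat_sub rho s t : sat rho (sub s t) <-> below (eval rho s) (eval rho t).
Proof.
  unfold below; simpl; split; intros [H1 H2]; split; intros x;
    specialize (H1 x); specialize (H2 x); now rewrite !eval_lift in *.
Qed.

Lemma univ_limit f : class f -> isU (#l_ ∘ f) /\ below f (#l_ ∘ f).
Proof.
  intros Hf.
  destruct (HM (f .: base) (vfu_limit (Var 0))) as [H1 H2].
  - now apply sat_Cl.
  - split; [exact H1|exact (proj1 (sat_sub _ _ _) H2)].
Qed.

Lemma univ_ex : exists u, isU u.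
Proof. exact (proj1 (sat_Ex _ _) (HM base vfu_nonempty)). Qed.

(** * Reasoning inside a single universe *)

Section Universe.
Variable u : M.
Hypothesis Hu : isU u.

(** The axiom speaks of a term for the universe. The element [u] is supplied as variable 0 of an
    enlarged environment and [A] is lifted past it, which changes neither its truth nor its
    evaluated code. Several axioms below are used in the same way. *)
Lemma univ_out rho A : U_free A -> holds u rho A -> sat rho A.
Proof.
  intros HA H; apply (sat_lift_fm rho u).
  apply (HM (u .: rho) (vfu_out (Var 0) (U_free_subst _ HA))); trivial.
  change (isT (u ∘ cd (u .: rho) (lift_fm A))); now rewrite cd_lift.
Qed.

Lemma univ_mp rho A B :
  U_free A -> U_free B -> holds u rho (A → B) -> holds u rho A -> holds u rho B.
Proof.
  intros HA HB H1 H2.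
  pose proof (HM (u .: rho) (vfu_imp (Var 0)
    (U_free_subst (fun n => Var (1 + n)) HA)
    (U_free_subst (fun n => Var (1 + n)) HB)) Hu) as H.
  change (isT (u ∘ cd (u .: rho) (lift_fm (A → B))) ->
    isT (u ∘ cd (u .: rho) (lift_fm A)) ->
    isT (u ∘ cd (u .: rho) (lift_fm B))) in H.
  rewrite !cd_lift in H; exact (H H1 H2).
Qed.

Lemma univ_all rho A :
  U_free A -> (forall d, holds u (d .: rho) A) -> holds u rho (All A).
Proof.
  intros HA H.
  pose proof (HM (u .: rho) (vfu_all (Var 0)
    (U_free_subst (up (fun n => Var (1 + n))) HA)) Hu) as HAll.
  unfold holds; rewrite <- (cd_lift rho u (All A)); apply HAll.
  intros d.
  change (isT (u ∘
    cd (d .: u .: rho) (subst_fm (up (fun n => Var (1 + n))) A))).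
  rewrite cd_subst, (eval_up (u .: rho) d (fun n => Var (1 + n))); apply H.
Qed.

Lemma univ_valid rho C : U_free C -> valid C -> holds u rho C.
Proof.
  intros HC HV.
  assert (HV' : valid (lift_fm C)) by (intros N r; apply sat_subst, HV).
  pose proof (HM (u .: rho) (vfu_log (Var 0)
    (U_free_subst (fun n => Var (1 + n)) HC) HV') Hu) as H.
  unfold holds; now rewrite <- (cd_lift rho u C).
Qed.

(** The implication is valid, hence holds in [u], and [u] is closed under modus ponens. Validity
    concerns all structures, so the premise ranges over every [N], where T is an arbitrary
    predicate. *)
Lemma univ_log rho A B :
  U_free A -> U_free B ->
  (forall (N : structure sigFS) (r : nat -> N), sat r A -> sat r B) ->
  holds u rho A -> holds u rho B.
Proof.
  intros HA HB HV; apply univ_mp; trivial.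
  apply univ_valid; simpl; auto; exact HV.
Qed.

Lemma univ_log2 rho A B C :
  U_free A -> U_free B -> U_free C ->
  (forall (N : structure sigFS) (r : nat -> N),
     sat r A -> sat r B -> sat r C) ->
  holds u rho A -> holds u rho B -> holds u rho C.
Proof.
  intros HA HB HC HV H1; apply univ_mp; trivial.
  revert H1; apply univ_log; simpl; auto; exact HV.
Qed.

Lemma univ_cons x : isT (u ∘ x) -> ~ isT (u ∘ (#dNeg ∘ x)).
Proof.
  intros H1 H2.
  exact (HM (u .: x .: base) (vfu_cons (Var 0) (Var 1)) Hu (conj H1 H2)).
Qed.

Lemma univ_true x : isT (u ∘ x) -> isT x.
Proof. exact (HM (u .: x .: base) (vfu_true (Var 0) (Var 1)) Hu). Qed.

Lemma univ_class : class u.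
Proof. exact (proj1 (sat_Cl _ _) (HM (u .: base) (vfu_class (Var 0)) Hu)). Qed.

(** The code of T(t) is [dTrue] applied to [t], so this is the axiom that T(ux) and T(u(Ṫx)) are
    equivalent. *)
Lemma holds_T rho t : holds u rho (T t) <-> isT (u ∘ eval rho t).
Proof.
  destruct (proj1 (HM (u .: eval rho t .: base) (vfu_rep (Var 0) (Var 1)) Hu)).
  split; trivial.
Qed.

Lemma holds_not_T rho t :
  holds u rho (¬ T t) <-> isT (u ∘ (#dNeg ∘ eval rho t)).
Proof.
  destruct (proj2 (HM (u .: eval rho t .: base) (vfu_rep (Var 0) (Var 1)) Hu)).
  split; trivial.
Qed.

Lemma decides_T rho t :
  isT (u ∘ eval rho t) \/ isT (u ∘ (#dNeg ∘ eval rho t)) ->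
  decides u rho (T t).
Proof. unfold decides; now rewrite holds_T, holds_not_T. Qed.

(** The literal axiom covers only literals of L, whereas [s] and [t] may contain constants of L_FS.
    They are replaced by variables whose values are stored in [r]. *)
Lemma decides_Eq rho s t : decides u rho (s ≐ t).
Proof.
  set (r := u .: eval rho s .: eval rho t .: base).
  destruct (classic (eval rho s = eval rho t)) as [E|E]; [left|right].
  - exact (HM r (@vfu_literal (Var 0) (Var 1 ≐ Var 2) I) Hu E).
  - exact (HM r (@vfu_literal (Var 0) (¬ (Var 1 ≐ Var 2)) I) Hu E).
Qed.

Lemma decides_Nat rho t : decides u rho (Nat t).
Proof.
  set (r := u .: eval rho t .: base).
  destruct (classic (isN (eval rho t))) as [E|E]; [left|right].
  - exact (HM r (@vfu_literal (Var 0) (Nat (Var 1)) I) Hu E).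
  - exact (HM r (@vfu_literal (Var 0) (¬ (Nat (Var 1))) I) Hu E).
Qed.

Lemma decides_holds rho A :
  U_free A -> decides u rho A -> sat rho A -> holds u rho A.
Proof.
  intros HA [H|H] HS; trivial.
  now destruct (univ_out (A := ¬ A) HA H).
Qed.

Lemma decides_holds_not rho A :
  U_free A -> decides u rho A -> ~ sat rho A -> holds u rho (¬ A).
Proof.
  intros HA [H|H] HS; trivial.
  now destruct (HS (univ_out HA H)).
Qed.

Lemma decides_Neg rho A : U_free A -> decides u rho A -> decides u rho (¬ A).
Proof.
  intros HA [H|H]; [right|now left].
  revert H; apply univ_log; simpl; tauto.
Qed.

Lemma decides_And rho A B :
  U_free A -> U_free B -> decides u rho A -> decides u rho B ->
  decides u rho (A ∧ B).
Proof.
  intros HA HB [H1|H1]; [intros [H2|H2]; [left|right]|right].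
  - revert H1 H2; apply univ_log2; simpl; tauto.
  - revert H2; apply univ_log; simpl; tauto.
  - revert H1; apply univ_log; simpl; tauto.
Qed.

Lemma decides_Imp rho A B :
  U_free A -> U_free B -> decides u rho A -> decides u rho B ->
  decides u rho (A → B).
Proof.
  intros HA HB [H1|H1]; [intros [H2|H2]; [left|right]|left].
  - revert H2; apply univ_log; simpl; tauto.
  - revert H1 H2; apply univ_log2; simpl; tauto.
  - revert H1; apply univ_log; simpl; tauto.
Qed.

(** By the omega rule over the domain of [M]: either every instance holds in [u], or one instance is
    refuted in [u] and refutes the universal formula. *)
Lemma decides_All rho A :
  U_free A -> (forall d, decides u (d .: rho) A) -> decides u rho (All A).
Proof.
  intros HA H; destruct (classic (forall d, holds u (d .: rho) A)) as [H1|H1].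
  - left; now apply univ_all.
  - right; apply not_all_ex_not in H1; destruct H1 as [d Hd].
    destruct (H d) as [H1|H1]; [contradiction|].
    (* The counterexample [d] is kept as variable 0 and [All A] is lifted past it, so that passing
       from ¬A(d) to ¬∀A becomes a logical consequence between formulas under one environment. *)
    unfold holds; rewrite <- (cd_lift rho d).
    revert H1; apply (univ_log (B := lift_fm (¬ All A))); trivial.
    + exact (U_free_subst (A := ¬ All A) _ HA).
    + intros N r HN.
      assert (E : r = env_cons (r 0) (fun n => r (1 + n))).
      { now extensionality n; destruct n. }
      rewrite E in HN |- *; apply sat_lift_fm.
      intros HA'; apply HN, HA'.
Qed.

End Universe.

(** The constant function with the true value [cd rho A] is a class, so its limit is a universe
    containing that code; reflection in this universe yields [A]. *)
Lemma T_out rho A : U_free A -> isT (cd rho A) -> sat rho A.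
Proof.
  intros HA H; destruct (@univ_limit ('k_ ∘ cd rho A)) as [HU [HB _]].
  - intros x; left; now rewrite k_eq.
  - apply (univ_out HU HA); specialize (HB 'zero_); rewrite k_eq in HB.
    now apply HB.
Qed.

Lemma T_cons x : isT x -> ~ isT (#dNeg ∘ x).
Proof.
  intros H1 H2; destruct (@univ_limit ('k_ ∘ x)) as [HU [HB1 HB2]].
  - intros y; left; now rewrite k_eq.
  - specialize (HB1 x); specialize (HB2 x); rewrite k_eq in HB1, HB2.
    now apply (univ_cons HU (HB1 H1)), HB2.
Qed.

(** The universe may vary with [x]. Whatever it decides is true outright, which makes [f] a class; T
    is sound for codes by [T_out], so the class has the intended members. *)
Lemma class_intro rho A f :
  U_free A -> (forall x, f ∘ x = cd (x .: rho) A) ->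
  (forall x, exists u, isU u /\ decides u (x .: rho) A) ->
  class f /\ forall x, isT (f ∘ x) <-> sat (x .: rho) A.
Proof.
  intros HA E HD.
  assert (Hf : class f).
  { intros x; rewrite E; destruct (HD x) as [u [Hu [H|H]]]; [left|right];
      exact (univ_true Hu H). }
  split; [exact Hf|]; intros x; specialize (Hf x); rewrite E in *.
  split; [now apply T_out|]; intros HS; destruct Hf as [H|H]; trivial.
  now destruct (T_out (A := ¬ A) HA H).
Qed.

Lemma decides_T_below u a x rho t :
  isU u -> class a -> below a u -> eval rho t = a ∘ x -> decides u rho (T t).
Proof.
  intros Hu Ha [H1 H2] E; apply decides_T; trivial; rewrite E.
  destruct (Ha x); auto.
Qed.

(** * Sums of classes and common universes *)

Definition osum a b : M := eval (a .: b .: base) (oplus (Var 0) (Var 1)).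

Lemma eval_oplus rho s t :
  eval rho (oplus s t) = osum (eval rho s) (eval rho t).
Proof.
  transitivity
    (eval rho (subst_tm (scons s (scons t Var)) (oplus (Var 0) (Var 1)))).
  - f_equal; unfold oplus; now rewrite subst_lam, <- code_subst.
  - rewrite eval_subst; unfold osum; unfold oplus; apply eval_closed with 2.
    + cbv; repeat split; lia.
    + intros [|[|m]] Hm; trivial; lia.
Qed.

Let osum_tm : tm sigFS :=
  Cst dN_ · (Var 1 · (Cst p1_ · Var 0)) · (Var 2 · (Cst p1_ · Var 0))
    · (Cst p0_ · Var 0) · Cst zero_.

Let osum_fm : fm sigFS := Nat (Cst p0_ · Var 0) → T osum_tm.

Section Sum.
Variables a b : M.
Hypotheses (Ha : class a) (Hb : class b).

(** If (x)_0 is 0, the atom is one of [a]; if it is another number, one of [b]; the limit of that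
    class decides it. If (x)_0 is not a number, the implication holds vacuously in any universe. *)
Lemma osum_class :
  class (osum a b) /\
  forall x, isT (osum a b ∘ x) <-> sat (x .: a .: b .: base) osum_fm.
Proof.
  apply class_intro; [simpl; tauto|intros x; apply eval_lam|].
  intros x; destruct (classic (isN ('p0_ ∘ x))) as [HN|HN].
  - assert (HT : exists u,
      isU u /\ decides u (x .: a .: b .: base) (T osum_tm)).
    { destruct (classic ('p0_ ∘ x = 'zero_)) as [E|E].
      - destruct (univ_limit Ha) as [HU HB]; exists (#l_ ∘ a); split; trivial.
        apply (decides_T_below (a := a) (x := 'p1_ ∘ x)); trivial.
        apply cases_eq; auto using zero_nat.
      - destruct (univ_limit Hb) as [HU HB]; exists (#l_ ∘ b); split; trivial.
        apply (decides_T_below (a := b) (x := 'p1_ ∘ x)); trivial.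
        apply cases_neq; auto using zero_nat. }
    destruct HT as [u [Hu HT]]; exists u; split; trivial.
    apply decides_Imp; simpl; trivial; now apply decides_Nat.
  - destruct univ_ex as [u Hu]; exists u; split; trivial; left.
    assert (H : holds u (x .: a .: b .: base) (¬ Nat (Cst p0_ · Var 0))).
    { apply decides_holds_not; simpl; trivial; now apply decides_Nat. }
    revert H; apply univ_log; simpl; tauto.
Qed.

Variable u : M.
Hypotheses (Hu : isU u) (Hsum : below (osum a b) u).

(** [u] directly inherits only codes of implications N((z)_0) → T(...). Since N((z)_0) holds in [u],
    so does the atom; a negated implication gives the negated atom by logic. The dot of T is then
    removed by [holds_T] and [holds_not_T]. *)
Lemma osum_below_at c x z :
  class c -> isN ('p0_ ∘ z) ->
  'dN_ ∘ (a ∘ ('p1_ ∘ z)) ∘ (b ∘ ('p1_ ∘ z)) ∘ ('p0_ ∘ z) ∘ 'zero_ = c ∘ x ->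
  (isT (c ∘ x) -> isT (u ∘ (c ∘ x))) /\
  (isT (#dNeg ∘ (c ∘ x)) -> isT (u ∘ (#dNeg ∘ (c ∘ x)))).
Proof.
  intros Hc HN E; destruct osum_class as [H1 H2], Hsum as [B1 B2].
  specialize (H1 z); specialize (H2 z); specialize (B1 z); specialize (B2 z).
  set (r := z .: a .: b .: base) in *.
  assert (E' : eval r osum_tm = c ∘ x) by exact E.
  assert (H2' : isT (osum a b ∘ z) <-> isT (c ∘ x)).
  { rewrite H2; unfold osum_fm; cbn [sat]; rewrite <- E'; tauto. }
  assert (Ecd : osum a b ∘ z = cd r (Nat (Cst p0_ · Var 0) → T osum_tm))
    by apply eval_lam.
  assert (HNu : holds u r (Nat (Cst p0_ · Var 0))).
  { apply decides_holds; simpl; trivial; now apply decides_Nat. }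
  split; intros H.
  - apply H2', B1 in H; rewrite <- E'; apply holds_T; trivial.
    rewrite Ecd in H; revert H HNu; now apply univ_mp.
  - assert (H' : isT (#dNeg ∘ (osum a b ∘ z))).
    { destruct H1 as [H1|H1]; trivial; now destruct (T_cons (proj1 H2' H1)). }
    apply B2 in H'; rewrite <- E'; apply holds_not_T; trivial.
    rewrite Ecd in H'.
    change (holds u r (¬ (Nat (Cst p0_ · Var 0) → T osum_tm))) in H'.
    revert H'; apply univ_log; simpl; tauto.
Qed.

Lemma below_l : below a u.
Proof.
  assert (E : forall x, 'dN_ ∘ (a ∘ ('p1_ ∘ pair 'zero_ x)) ∘
    (b ∘ ('p1_ ∘ pair 'zero_ x)) ∘ ('p0_ ∘ pair 'zero_ x) ∘ 'zero_ = a ∘ x).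
  { intros x; rewrite p0_eq, p1_eq; apply cases_eq; auto using zero_nat. }
  assert (HN : forall x, isN ('p0_ ∘ pair 'zero_ x)).
  { intros x; rewrite p0_eq; apply zero_nat. }
  split; intros x; apply (osum_below_at Ha (HN x) (E x)).
Qed.

Lemma below_r : below b u.
Proof.
  (* Index 0 selects [a] and every other number selects [b]; 1 is taken here. *)
  set (one := 'sN_ ∘ 'zero_).
  assert (E : forall x, 'dN_ ∘ (a ∘ ('p1_ ∘ pair one x)) ∘
    (b ∘ ('p1_ ∘ pair one x)) ∘ ('p0_ ∘ pair one x) ∘ 'zero_ = b ∘ x).
  { intros x; rewrite p0_eq, p1_eq; apply cases_neq.
    split; [apply succ_nat, zero_nat|]; split; [apply zero_nat|].
    apply pred_succ, zero_nat. }
  assert (HN : forall x, isN ('p0_ ∘ pair one x)).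
  { intros x; rewrite p0_eq; apply succ_nat, zero_nat. }
  split; intros x; apply (osum_below_at Hb (HN x) (E x)).
Qed.

End Sum.

Lemma univ_sum a b :
  class a -> class b ->
  exists u, isU u /\ below a u /\ below b u.
Proof.
  intros Ha Hb; destruct (osum_class Ha Hb) as [Hc _].
  destruct (univ_limit Hc) as [HU HB].
  exists (#l_ ∘ osum a b); split; [exact HU|].
  split; [now apply below_l with b|now apply below_r with a].
Qed.

(** * Inductive generation *)

Definition TI_sem a b z : Prop :=
  isT (a ∘ z) /\
  forall f,
    (forall x, isT (a ∘ x) ->
      (forall y, isT (a ∘ y) -> isT (b ∘ pair y x) ->
         isT (#l_ ∘ osum a b ∘ (f ∘ y))) ->
      isT (#l_ ∘ osum a b ∘ (f ∘ x))) ->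
    isT (#l_ ∘ osum a b ∘ (f ∘ z)).

Lemma eval_l_of rho s t :
  eval rho (l_of s t) = #l_ ∘ osum (eval rho s) (eval rho t).
Proof. unfold l_of; cbn [eval]; now rewrite eval_oplus. Qed.

Lemma sat_TI rho s t r :
  sat rho (TI s t r) <-> TI_sem (eval rho s) (eval rho t) (eval rho r).
Proof.
  unfold TI, WF, TI_sem; cbn [sat eval].
  apply and_iff_compat_l.
  split; intros H f Hf; specialize (H f); rewrite !eval_lift, eval_l_of in *;
    apply H; intros x Hx Hy; specialize (Hf x);
    rewrite !eval_lift, ?eval_l_of, ?eval_lift in *; apply Hf; trivial;
    intros y Hy1 Hy2; specialize (Hy y);
    rewrite !eval_lift, ?eval_l_of, ?eval_lift in *; now apply Hy.
Qed.

Section Acc.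
Variables a b : M.
Hypotheses (Ha : class a) (Hb : class b).

(** [ac] stands for acc(a, b) and is known only through its values; [i_eq] later supplies this
    equation for the translated generator. *)
Variable ac : M.
Let e : nat -> M := pair a b .: base.
Hypothesis ac_eq : forall z,
  ac ∘ z = cd (z .: e) (TI (Cst p0_ · Var 1) (Cst p1_ · Var 1) (Var 0)).

(** The atoms of TI belong to [a], [b] and the universe v = l(a ⊕ b). As v is itself a class, there
    is a universe [u] above both a ⊕ b and v; it decides all these atoms and hence TI. *)
Lemma acc_class : class ac /\ forall z, isT (ac ∘ z) <-> TI_sem a b z.
Proof.
  destruct (@class_intro e
    (TI (Cst p0_ · Var 1) (Cst p1_ · Var 1) (Var 0)) ac) as [H1 H2].
  - simpl; tauto.
  - exact ac_eq.
  - destruct (osum_class Ha Hb) as [Hc _].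
    destruct (univ_limit Hc) as [HU _].
    set (v := #l_ ∘ osum a b) in *.
    destruct (univ_sum Hc (univ_class HU)) as [u (Hu & B1 & B2)].
    pose proof (below_l Ha Hb Hu B1) as Bl.
    pose proof (below_r Ha Hb Hu B1) as Br.
    intros z; exists u; split; trivial.
    unfold TI, WF.
    apply decides_And; simpl U_free; try tauto.
    { apply decides_T_below with (a := a) (x := z); trivial.
      simpl; now rewrite p0_eq. }
    apply decides_All; simpl U_free; try tauto; intros f.
    apply decides_Imp; simpl U_free; try tauto.
    2: { apply decides_T_below with (a := v) (x := f ∘ z);
           auto using univ_class.
         cbn [eval]; rewrite !eval_lift, eval_l_of; simpl.
         now rewrite p0_eq, p1_eq. }
    apply decides_All; simpl U_free; try tauto; intros x.
    apply decides_Imp; simpl U_free; try tauto.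
    { apply decides_T_below with (a := a) (x := x); trivial.
      simpl; now rewrite p0_eq. }
    apply decides_Imp; simpl U_free; try tauto.
    2: { apply decides_T_below with (a := v) (x := f ∘ x);
           auto using univ_class.
         cbn [eval]; rewrite !eval_lift, eval_l_of; simpl.
         now rewrite p0_eq, p1_eq. }
    apply decides_All; simpl U_free; try tauto; intros y.
    apply decides_Imp; simpl U_free; try tauto.
    { apply decides_T_below with (a := a) (x := y); trivial.
      simpl; now rewrite p0_eq. }
    apply decides_Imp; simpl U_free; try tauto.
    { apply decides_T_below with (a := b) (x := pair y x); trivial.
      simpl; now rewrite p1_eq. }
    apply decides_T_below with (a := v) (x := f ∘ y);
      auto using univ_class.
    cbn [eval]; rewrite !eval_lift, eval_l_of; simpl.
    now rewrite p0_eq, p1_eq.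
  - split; trivial; intros z; rewrite H2, sat_TI; simpl.
    now rewrite p0_eq, p1_eq.
Qed.

(** Given a progressive [f], TI of each predecessor [y] is applied to this same [f]; that is the
    premise which progressiveness demands at [x]. *)
Lemma acc_closed x :
  isT (a ∘ x) ->
  (forall y, isT (a ∘ y) -> isT (b ∘ pair y x) -> isT (ac ∘ y)) ->
  isT (ac ∘ x).
Proof.
  destruct acc_class as [_ HT]; intros Hx H; apply HT; split; trivial.
  intros f Hf; apply Hf; trivial.
  intros y Hy Hyx; now apply (proj1 (HT y) (H y Hy Hyx)).
Qed.

(* In [at_ m] the variable 0 is that of [A] and its parameters start at [m];
   [clo] is Closed(A), [D] is Closed(A) → A(x), and [D'] is [D] with y for x. *)
Lemma acc_ind rho A :
  U_free A ->
  (forall x, isT (a ∘ x) ->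
     (forall y, isT (a ∘ y) -> isT (b ∘ pair y x) -> sat (y .: rho) A) ->
     sat (x .: rho) A) ->
  forall x, isT (ac ∘ x) -> sat (x .: rho) A.
Proof.
  intros HA Hcl x Hx; apply acc_class in Hx; destruct Hx as [_ Hx].
  destruct (osum_class Ha Hb) as [Hc _].
  destruct (univ_limit Hc) as [Hu Bu].
  pose proof (below_l Ha Hb Hu Bu) as Bl.
  pose proof (below_r Ha Hb Hu Bu) as Br.
  set (u := #l_ ∘ osum a b) in *.
  set (at_ := fun m => subst_fm (scons (Var 0) (fun n => Var (m + n))) A).
  set (clo := All (T (Var 1 · Var 0) →
                   All (T (Var 2 · Var 0) → T (Var 3 · ⟨Var 0, Var 1⟩) →
                        at_ 4) →
                   at_ 3)).
  set (D := lift_fm clo → at_ 3).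
  set (D' := subst_fm (scons (Var 0) (fun n => Var (2 + n))) D).
  set (r := a .: b .: rho).
  assert (HAt : forall m, U_free (at_ m)) by (intros m; now apply U_free_subst).
  assert (Hclo : U_free clo) by (simpl; auto).
  assert (HD : U_free D) by (split; [now apply U_free_subst|trivial]).
  assert (HD' : U_free D') by now apply U_free_subst.
  assert (Hat : forall (N : structure sigFS) (q : nat -> N) m,
    sat q (at_ m) <-> sat (env_cons (q 0) (fun n => q (m + n))) A).
  { intros N q m; unfold at_; rewrite sat_subst.
    now rewrite (eval_scons q (Var 0) (fun n => Var (m + n))). }
  assert (HD'E : forall (N : structure sigFS) (q : nat -> N) (y : N),
    sat (env_cons y q) D' <-> sat (env_cons y (fun n => q (1 + n))) D).
  { intros N q y; unfold D'; rewrite sat_subst.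
    now rewrite (eval_scons (env_cons y q) (Var 0) (fun n => Var (2 + n))). }
  (* It suffices that [D] at [x] holds in [u]: reflection makes it true, and the hypothesis on [A]
     discharges its premise. *)
  assert (Hx' : holds u (x .: r) D).
  2: { apply (univ_out Hu HD) in Hx'.
       apply (Hat M (x .: r) 3), Hx', sat_lift_fm.
       intros z Hz Hy; apply (Hat M (z .: r) 3), Hcl; [exact Hz|].
       intros y Hy1 Hy2; exact (proj1 (Hat M _ 4) (Hy y Hy1 Hy2)). }
  (* The test function takes [a], [b] and the parameters of [A] from [r]; its progressiveness in [u]
     remains to be shown. *)
  specialize (Hx (eval r (lam (code D)))); rewrite eval_lam in Hx.
  apply Hx; clear x Hx; intros x Hx Hy; rewrite eval_lam.
  assert (H1 : holds u (x .: r) (T (Var 1 · Var 0))).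
  { apply holds_T; trivial; now apply Bl. }
  assert (H2 : holds u (x .: r)
    (All (T (Var 2 · Var 0) → T (Var 3 · ⟨Var 0, Var 1⟩) → D'))).
  { apply univ_all; [trivial|now simpl|]; intros y; specialize (Hy y).
    assert (E : cd (y .: x .: r) D' = cd (y .: r) D).
    { unfold D'; rewrite cd_subst.
      now rewrite (eval_scons (y .: x .: r) (Var 0) (fun n => Var (2 + n))). }
    (* If [u] refutes T(ay) or T(b(y, x)), the implication holds in [u] vacuously; otherwise [D] at
       [y] is available from [Hy]. *)
    destruct (Ha y) as [H|H].
    2: { apply Bl in H.
         apply (holds_not_T Hu (y .: x .: r) (Var 2 · Var 0)) in H.
         revert H; apply univ_log; simpl; tauto. }
    destruct (Hb (pair y x)) as [H'|H'].
    2: { apply Br in H'.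
         apply (holds_not_T Hu (y .: x .: r) (Var 3 · ⟨Var 0, Var 1⟩)) in H'.
         revert H'; apply univ_log; simpl; tauto. }
    specialize (Hy H H'); rewrite eval_lam, <- E in Hy.
    revert Hy; apply (univ_log Hu (A := D')); simpl; tauto. }
  (* Pure logic from here, checked in an arbitrary structure [N]: under Closed(A), [D] at each
     predecessor y gives A(y), and hence A(x). *)
  revert H1 H2; apply univ_log2; [trivial|now simpl|now simpl|trivial|].
  intros N q H1 H2 Hq.
  assert (Eq : q = env_cons (q 0) (fun n => q (1 + n))).
  { now extensionality n; destruct n. }
  rewrite Eq in Hq; apply sat_lift_fm in Hq; rewrite Eq.
  apply (Hq (q 0)); [exact H1|].
  intros y Hy1 Hy2; apply Hat.
  assert (HDy := proj1 (HD'E N q y) (H2 y Hy1 Hy2)).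
  exact (proj1 (Hat N _ 3) (HDy (proj2 (sat_lift_fm _ _ _) Hq))).
Qed.

End Acc.

End Model.

(** * The interpretation of T0 *)

(** Under two abstractions, outside quantifiers, variable 0 is the element and variable 1 the
    argument, a pair for the binary generators. The existentials in the axioms of [id] and [j] are
    expressed by projections, so that no quantifier has to be decided there. *)
Definition gen (c : em_con) : tm sigFS :=
  match c with
  | nat_ => lam (code (Nat (Var 0)))
  | id_ => lam (code (Var 0 ≐ ⟨Cst p0_ · Var 0, Cst p0_ · Var 0⟩))
  | co_ => lam (lam (code (¬ T (Var 1 · Var 0))))
  | int_ =>
      lam (lam (code (T (Cst p0_ · Var 1 · Var 0) ∧
                      T (Cst p1_ · Var 1 · Var 0))))
  | dom_ => lam (lam (code (Ex (T (Var 2 · ⟨Var 1, Var 0⟩)))))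
  | inv_ =>
      lam (lam (code (T (Cst p0_ · Var 1 · (Cst p1_ · Var 1 · Var 0)))))
  | j_ =>
      lam (lam (code (
        Var 0 ≐ ⟨Cst p0_ · Var 0, Cst p1_ · Var 0⟩ ∧
        T (Cst p0_ · Var 1 · (Cst p0_ · Var 0)) ∧
        T (Cst p1_ · Var 1 · (Cst p0_ · Var 0) · (Cst p1_ · Var 0)))))
  | i_ => acc
  end.

Lemma closed_gen c : closed_tm 0 (gen c).
Proof. destruct c; cbv; repeat split; lia. Qed.

Section Interpretation.
Variable M : structure sigFS.
Hypothesis HM : models M VFU.

Infix "∘" := (@m_app sigFS M) (at level 40, left associativity).
Infix ".:" := (@env_cons sigFS M) (at level 55, right associativity).
Notation "' c" := (m_lcon M c) (at level 9, format "' c").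
Notation isN := (@m_nat sigFS M).
Notation isT := (@m_rel1 sigFS M relT).
Notation isU := (@m_rel1 sigFS M relU).
Notation pair x y := ('p_ ∘ x ∘ y).
Notation class := (class (M := M)).

Let base : nat -> M := fun _ => 'zero_.

Definition em_model : structure sigEM :=
  @Structure sigEM M (m_lcon M) (fun c => eval base (gen c)) (@m_app sigFS M)
    isN (fun _ x => class x) (fun _ x y => isT (y ∘ x)).

Lemma eval_tr rho t :
  eval (M := em_model) rho t = eval (M := M) rho (tr_tm gen t).
Proof.
  induction t as [n|c|c|t1 IH1 t2 IH2]; simpl; trivial.
  - apply eval_closed with 0; [apply closed_gen|intros m Hm; lia].
  - now rewrite IH1, IH2.
Qed.

Lemma sat_tr A : forall rho : nat -> M,
  sat (M := em_model) rho A <-> sat rho (tr gen A).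
Proof.
  induction A as [t1 t2|t|[] t|[] t1 t2|A IH|A IHA B IHB|A IHA B IHB|A IH];
    intros rho; cbn [tr]; try rewrite sat_Cl;
    cbn [sat m_nat m_rel1 m_rel2 em_model]; rewrite ?eval_tr; try reflexivity.
  - now rewrite IH.
  - now rewrite IHA, IHB.
  - now rewrite IHA, IHB.
  - split; intros H d; specialize (H d); now apply IH.
Qed.

(** U-free formulas have proper codes, so [acc_ind], which reflects through codes, covers the
    translation of every formula of L_EM. *)
Lemma U_free_tr A : U_free (tr gen A).
Proof. induction A as [| |[]|[]| | | |]; simpl; tauto. Qed.

Notation "! c" := (eval base (gen c)) (at level 9, format "! c").

Lemma gen_class c A (a : M) :
  gen c = lam (lam (code A)) -> U_free A ->
  (forall x, exists u, isU u /\ decides u (x .: a .: base) A) ->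
  class (!c ∘ a) /\
  forall x, isT (!c ∘ a ∘ x) <-> sat (x .: a .: base) A.
Proof.
  intros E HA; apply class_intro; trivial.
  intros x; rewrite E; rewrite !eval_lam; trivial.
Qed.

(** * Classes for the generators other than [i] *)

Lemma nat_class : class !nat_ /\ forall x, isT (!nat_ ∘ x) <-> isN x.
Proof.
  apply (@class_intro M HM base (Nat (Var 0))); [exact I| |].
  - intros x; now apply eval_lam.
  - intros x; destruct (univ_ex HM) as [u Hu]; exists u; split; trivial.
    now apply decides_Nat.
Qed.

Lemma id_class :
  class !id_ /\ forall x, isT (!id_ ∘ x) <-> exists y, x = pair y y.
Proof.
  destruct (@class_intro M HM base
    (Var 0 ≐ ⟨Cst p0_ · Var 0, Cst p0_ · Var 0⟩) !id_) as [H1 H2];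
    [exact I| | |].
  - intros x; now apply eval_lam.
  - intros x; destruct (univ_ex HM) as [u Hu]; exists u; split; trivial.
    now apply decides_Eq.
  - split; trivial; intros x; rewrite H2; simpl; split.
    + intros E; now exists ('p0_ ∘ x).
    + intros [y ->]; now rewrite p0_eq.
Qed.

Lemma co_class a :
  class a ->
  class (!co_ ∘ a) /\ forall x, isT (!co_ ∘ a ∘ x) <-> ~ isT (a ∘ x).
Proof.
  intros Ha.
  apply (gen_class (c := co_) (A := ¬ T (Var 1 · Var 0))); simpl; trivial.
  intros x; destruct (univ_limit HM Ha) as [Hu Hb].
  eexists; split; [exact Hu|]; apply decides_Neg; simpl; trivial.
  now apply (decides_T_below HM (a := a) (x := x)).
Qed.

Lemma int_class a b :
  class a -> class b ->
  class (!int_ ∘ pair a b) /\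
  forall x, isT (!int_ ∘ pair a b ∘ x) <-> isT (a ∘ x) /\ isT (b ∘ x).
Proof.
  intros Ha Hb; destruct (@gen_class int_ _ (pair a b) eq_refl)
    as [H1 H2]; simpl; [tauto| |].
  - intros x; destruct (univ_sum HM Ha Hb) as (u & Hu & B1 & B2).
    exists u; split; trivial; apply decides_And; simpl; trivial.
    + apply (decides_T_below HM (a := a) (x := x)); simpl; trivial.
      now rewrite p0_eq.
    + apply (decides_T_below HM (a := b) (x := x)); simpl; trivial.
      now rewrite p1_eq.
  - split; trivial; intros x; rewrite H2; simpl; now rewrite p0_eq, p1_eq.
Qed.

Lemma dom_class a :
  class a ->
  class (!dom_ ∘ a) /\
  forall x, isT (!dom_ ∘ a ∘ x) <-> exists y, isT (a ∘ pair x y).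
Proof.
  intros Ha; destruct (@gen_class dom_ _ a eq_refl) as [H1 H2];
    [simpl; tauto| |].
  - intros x; destruct (univ_limit HM Ha) as [Hu Hb].
    (* Existence is coded as ¬∀¬, and each layer preserves being decided. *)
    eexists; split; [exact Hu|]; apply decides_Neg; simpl; trivial.
    apply decides_All; simpl; trivial; intros y.
    apply decides_Neg; simpl; trivial.
    now apply (decides_T_below HM (a := a) (x := pair x y)).
  - split; trivial; intros x; now rewrite H2, sat_Ex.
Qed.

Lemma inv_class a f :
  class a ->
  class (!inv_ ∘ pair a f) /\
  forall x, isT (!inv_ ∘ pair a f ∘ x) <-> isT (a ∘ (f ∘ x)).
Proof.
  intros Ha; destruct (@gen_class inv_ _ (pair a f) eq_refl) as [H1 H2];
    [simpl; tauto| |].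
  - intros x; destruct (univ_limit HM Ha) as [Hu Hb].
    eexists; split; [exact Hu|].
    apply (decides_T_below HM (a := a) (x := f ∘ x)); simpl; trivial.
    now rewrite p0_eq, p1_eq.
  - split; trivial; intros x; rewrite H2; simpl; now rewrite p0_eq, p1_eq.
Qed.

(* The universe deciding membership of [z = (v, w)] depends on [v]; it only
   has to contain the class [f v] when [v] is in [a]. *)
Lemma join_class a f :
  class a -> (forall x, isT (a ∘ x) -> class (f ∘ x)) ->
  class (!j_ ∘ pair a f) /\
  forall z, isT (!j_ ∘ pair a f ∘ z) <->
    exists v w, z = pair v w /\ isT (a ∘ v) /\ isT (f ∘ v ∘ w).
Proof.
  intros Ha Hf; destruct (@gen_class j_ _ (pair a f) eq_refl) as [H1 H2];
    [simpl; tauto| |].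
  - intros z; set (v := 'p0_ ∘ z); set (w := 'p1_ ∘ z).
    assert (Ea : forall t, eval (z .: pair a f .: base) t = v ->
      eval (z .: pair a f .: base) (Cst p0_ · Var 1 · t) = a ∘ v).
    { intros t Et; simpl; now rewrite Et, p0_eq. }
    destruct (Ha v) as [Hv|Hv].
    + destruct (univ_sum HM Ha (Hf v Hv)) as (u & Hu & B1 & B2).
      exists u; split; trivial.
      repeat apply decides_And; simpl U_free; try tauto.
      * now apply decides_Eq.
      * now apply (decides_T_below HM (a := a) (x := v)), Ea.
      * apply (decides_T_below HM (a := f ∘ v) (x := w)); simpl; auto.
        now rewrite p1_eq.
    (* Outside [a] nothing is known about [f ∘ v]; the refuted middle conjunct refutes the whole
       conjunction. *)
    + destruct (univ_limit HM Ha) as [Hu Hb].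
      eexists; split; [exact Hu|]; right.
      apply Hb in Hv; rewrite <- (Ea (Cst p0_ · Var 0) eq_refl) in Hv.
      apply holds_not_T in Hv; trivial.
      revert Hv; apply univ_log; simpl; tauto.
  - split; trivial; intros z; rewrite H2; simpl.
    rewrite p0_eq, p1_eq by trivial.
    split.
    + intros H; now exists ('p0_ ∘ z), ('p1_ ∘ z).
    + intros (v & w & -> & H); now rewrite !p0_eq, !p1_eq.
Qed.

Lemma i_eq a b z :
  !i_ ∘ pair a b ∘ z =
  eval (z .: pair a b .: base)
    (code (TI (Cst p0_ · Var 1) (Cst p1_ · Var 1) (Var 0))).
Proof. now unfold gen, acc; rewrite !eval_lam. Qed.

(** * The axioms of T0 in the interpretation *)

Lemma em_models_TON A (rho : nat -> em_model) : TON A -> sat rho A.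
Proof.
  intros HA; destruct HA.
  - apply (k_eq HM).
  - apply (s_eq HM).
  - split; [apply (p0_eq HM)|apply (p1_eq HM)].
  - apply (zero_nat HM).
  - exact (succ_nat HM (x := eval rho x)).
  - exact (pred_succ HM (x := eval rho x)).
  - exact (succ_pred HM (x := eval rho x)).
  - exact (cases_eq HM (eval rho x) (eval rho y)
      (z := eval rho u) (w := eval rho v)).
  - exact (cases_neq HM (eval rho x) (eval rho y)
      (z := eval rho u) (w := eval rho v)).
  (* Induction for a formula of L_EM is induction in [M] for its translation. *)
  - intros [H0 HS] d Hd; apply sat_tr, nat_ind_sat; trivial.
    + now apply sat_inst, sat_tr in H0.
    + intros x Hx HA; apply sat_tr in HA; specialize (HS x Hx HA).
      apply sat_subst in HS; rewrite eval_scons in HS; now apply sat_tr.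
Qed.

Lemma em_models_T0 : models em_model T0.
Proof.
  intros A rho HA; destruct HA.
  - now apply em_models_TON.
  - split; [apply nat_class|]; intros x; apply sat_Iff, nat_class.
  - split; [apply id_class|]; intros x; apply sat_Iff; rewrite sat_Ex.
    apply id_class.
  - intros Ha; apply co_class in Ha; split; [apply Ha|].
    intros x; apply sat_Iff; cbn [sat]; rewrite !eval_lift.
    exact (proj2 Ha x).
  - intros [Ha Hb]; pose proof (int_class Ha Hb) as H; split; [apply H|].
    intros x; apply sat_Iff; cbn [sat]; rewrite !eval_lift.
    exact (proj2 H x).
  - intros Ha; apply dom_class in Ha; split; [apply Ha|].
    intros x; apply sat_Iff; rewrite sat_Ex; cbn [sat]; rewrite eval_lift.
    setoid_rewrite eval_lift; setoid_rewrite eval_lift.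
    exact (proj2 Ha x).
  - intros Ha; pose proof (inv_class (eval rho f) Ha) as H.
    split; [apply H|].
    intros x; apply sat_Iff; cbn [sat eval]; rewrite !eval_lift.
    exact (proj2 H x).
  - intros [Ha Hf].
    destruct (@join_class (eval rho x) (eval rho f)) as [H1 H2]; trivial.
    { intros v Hv; specialize (Hf v); cbn [sat eval] in Hf.
      rewrite !eval_lift in Hf; now apply Hf. }
    split; [exact H1|]; intros z; apply sat_Iff; rewrite sat_Ex.
    transitivity (exists v w : M, z = pair v w /\
      isT (eval rho x ∘ v) /\ isT (eval rho f ∘ v ∘ w)).
    + cbn [sat]; rewrite eval_lift; exact (H2 z).
    + split; intros [v H]; exists v; [apply sat_Ex|apply sat_Ex in H];
        destruct H as [w H]; exists w; cbn [sat eval] in *;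
        rewrite !eval_lift in *; exact H.
  - intros [Ha Hb]; pose proof (i_eq (eval rho a) (eval rho b)) as E.
    split; [apply (acc_class HM Ha Hb E)|].
    intros x Hx Hy; cbn [sat] in *; rewrite !eval_lift in *.
    apply (acc_closed HM Ha Hb E); trivial.
    intros y Hy1 Hy2; specialize (Hy y); cbn [sat subst_fm subst_tm] in Hy.
    rewrite !eval_lift, subst_tm_lift, eval_subst in Hy.
    exact (Hy Hy1 Hy2).
  - intros (Ha & Hb & Hcl); pose proof (i_eq (eval rho a) (eval rho b)) as E.
    intros x Hx; apply sat_tr.
    apply (acc_ind HM Ha Hb E); [apply U_free_tr| |].
    + clear x Hx; intros x Hx Hy; apply sat_tr, Hcl.
      * cbn [sat]; now rewrite eval_lift.
      * intros y Hy1 Hy2; cbn [sat] in Hy1, Hy2; rewrite !eval_lift in *.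
        apply sat_subst.
        rewrite (eval_scons (M := em_model) _ (Var 0) (fun n => Var (2 + n))).
        now apply sat_tr, Hy.
    + cbn [sat] in Hx; now rewrite eval_lift in Hx.
Qed.

End Interpretation.

(** * From models back to derivations *)

Lemma fs_enumerable :
  exists enum : nat -> fm sigFS, forall A, exists n, enum n = A.
Proof.
  apply (@fm_enumerable sigFS
    (fun c => match c with
      | dEq => 0 | dNeg => 1 | dAnd => 2 | dImp => 3
      | dAll => 4 | dNat => 5 | dTrue => 6 | l_ => 7
      end)
    (fun r => match r with relT => 0 | relU => 1 end)
    (fun r : Empty_set => match r with end)).
  - now intros [] [].
  - now intros [] [].
  - intros [].
Qed.

Lemma tr_sound A : (T0 ⊢ A) -> (VFU ⊢ tr gen A).
Proof.
  intros HA; destruct fs_enumerable as [enum Henum].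
  apply (completeness Henum); intros M HM rho.
  apply sat_tr, (soundness (em_models_T0 HM) HA); intros B [].
Qed.

Lemma tr_emb A : tr gen (emb sigEM A) = emb sigFS A.
Proof.
  assert (Ht : forall t, tr_tm gen (emb_tm sigEM t) = emb_tm sigFS t).
  { induction t as [|c|[]|]; simpl; congruence. }
  induction A as [| |[]|[]| | | |]; simpl; congruence.
Qed.

Theorem theorem7p10 :
  exists g : em_con -> tm sigFS,
    (forall c : em_con, closed_tm 0 (g c)) /\
    g i_ = acc /\
    (forall A : fm sigEM, sentence A -> (T0 ⊢ A) -> (VFU ⊢ tr g A)) /\
    (forall A : fm sigL, (T0 ⊢ emb sigEM A) -> (VFU ⊢ emb sigFS A)).
Proof.
  exists gen; split; [exact closed_gen|]; split; [reflexivity|]; split.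
  - intros A _; apply tr_sound.
  - intros A HA; rewrite <- tr_emb; now apply tr_sound.
Qed.
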